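(* Let $S$ be a semigroup and $X$ an operator $S$-space with semigroup action $\alpha\colon S\times X\to X$, $\alpha(s,x)=\alpha_s(x)$. Assume that one of the following hypotheses holds: (a) $X$ is a dual operator $S$-space and $S$ is amenable as a discrete semigroup; or (b) $X$ is a dual operator $S$-space, $S$ is an amenable locally compact topological group, and for each $x\in X$ the mapping $\alpha(\cdot,x)\colon S\to X$ is continuous with respect to the weak$^*$-topology of $X$; or (c) $X$ is a dual operator $S$-space, $S$ is an amenable topological group, and the natural action of $S$ on the predual $X_*$ of $X$ is strongly continuous (i.e. for every $\psi\in X_*$ the mapping $S\to X_*$, $s\mapsto(\alpha_s)^*\psi$, is norm continuous); or (d) $X$ is an operator $S$-space, $S$ is a compact left topological semigroup which is amenable as a discrete semigroup, and for each $x\in X$ the mapping $\alpha(\cdot,x)\colon S\to X$ is (norm) continuous; or (e) $X$ is an operator $S$-space which is separable as a Banach space, $S$ is a compact left topological semigroup which is amenable as a discrete semigroup, and for each $x\in X$ the mapping $\alpha(\cdot,x)\colon S\to X$ is weakly continuous; or (f) $S$ is a compact topological group and for each $x\in X$ the mapping $\alpha(\cdot,x)\colon S\to X$ is weakly continuous. Then there exists a linear map $P\colon X\to X$ such that: (i) $P$ is completely bounded and $\|P\|_{\mathrm{cb}}\le\sup_{s\in S}\|\alpha_s\|_{\mathrm{cb}}$; (ii) $\operatorname{Ran}P=X^S$, where $X^S=\{x\in X\mid \alpha_s(x)=x \text{ for all } s\in S\}$; (iii) $P\circ P=P$.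
   Context: Operator spaces are complex and norm complete; $X^*$ is the operator space dual. Operator $S$-space: for a semigroup $S$, an operator space $X$ equipped with a mapping $\alpha\colon S\times X\to X$, $\alpha(s,x)=\alpha_s(x)$, such that $\alpha_{st}=\alpha_s\circ\alpha_t$ for all $s,t\in S$, each $\alpha_s\colon X\to X$ is linear and completely bounded, and $\sup_{s\in S}\|\alpha_s\|_{\mathrm{cb}}<\infty$. Dual operator $S$-space: an operator $S$-space $X$ for which there is an operator space $X_*$ (the predual) with $X=(X_* )^*$ as operator spaces and $(\alpha_s)^*X_*\subseteq X_*\subseteq X^*$ for all $s\in S$ (equivalently, each $\alpha_s$ is weak$^*$-continuous). Amenability: for a semigroup $S$, let $\mathcal F_b(S)$ be the $C^*$-algebra of all bounded functions $S\to\mathbb C$ with the sup norm, and $(L_tf)(s)=f(ts)$. If $\mathcal T\subseteq\mathcal F_b(S)$ is a linear subspace containing the constants and invariant under all $L_t$, $t\in S$, then $\mathcal T$ is amenable if there is a linear functional $\mu\colon\mathcal T\to\mathbb C$ with $\|\mu\|=\mu(\mathbf 1)=1$ and $\mu\circ L_t=\mu$ for all $t\in S$. A semigroup $S$ is amenable (as a discrete semigroup) if $\mathcal F_b(S)$ is amenable. A topological group $S$ is amenable if the space of all bounded continuous $f\colon S\to\mathbb C$ for which $s\mapsto L_sf$ is continuous in the sup norm is amenable. Left topological semigroup: a semigroup $S$ with a topology such that for each $s\in S$ the mapping $t\mapsto st$ is continuous on $S$. *)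

(* Defs.v *)
From HB Require Import structures.
From mathcomp Require Import all_boot all_order all_algebra.
From mathcomp Require Import complex.
From mathcomp Require Import all_classical all_reals all_analysis.

Set Implicit Arguments.
Unset Strict Implicit.
Unset Printing Implicit Defensive.

Import Order.TTheory GRing.Theory Num.Theory.
Import numFieldNormedType.Exports.

Local Open Scope classical_set_scope.
Local Open Scope ring_scope.
Local Open Scope complex_scope.

Notation normc := Normc.normc.

Section ScalarMatrices.
Context {R : realType}.

Definition l2norm n (v : 'cV[R[i]]_n) : R :=
  Num.sqrt (\sum_i normc (v i 0) ^+ 2).

Definition opnorm m n (a : 'M[R[i]]_(m, n)) : R :=
  sup [set l2norm (a *m v) | v in [set v | l2norm v <= 1]].

(* The product a x b of x in M_n(X) with scalar matrices, entrywise because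
   the entries of x are vectors. *)
Definition mx_sandwich (X : lmodType R[i]) m n
    (a : 'M[R[i]]_(m, n)) (x : 'M[X]_n) (b : 'M[R[i]]_(n, m)) : 'M[X]_m :=
  \matrix_(i, j) \sum_k \sum_l (a i k * b l j) *: x k l.

End ScalarMatrices.

(* Ruan's axioms.  Matrix norms take values in R, whereas the library norm of
   a normed module over R[i] takes (nonnegative real) values in R[i]. *)
HB.mixin Record isOperatorSpace (R : realType) X
    & CompleteNormedModule R[i] X := {
  matnorm : forall n, 'M[X]_n -> R ;
  matnormD : forall n (x y : 'M[X]_n),
    matnorm n (x + y) <= matnorm n x + matnorm n y ;
  matnormZ : forall n (c : R[i]) (x : 'M[X]_n),
    matnorm n (map_mx ( *:%R c) x) = normc c * matnorm n x ;
  matnorm_eq0 : forall n (x : 'M[X]_n), matnorm n x = 0 -> x = 0 ;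
  matnorm1E : forall x : X, (matnorm 1 (const_mx x))%:C = `|x| ;
  matnorm_block : forall m n (x : 'M[X]_m) (y : 'M[X]_n),
    matnorm (m + n) (block_mx x 0 0 y) = Num.max (matnorm m x) (matnorm n y) ;
  matnorm_sandwich : forall m n
      (a : 'M[R[i]]_(m, n)) (x : 'M[X]_n) (b : 'M[R[i]]_(n, m)),
    matnorm m (mx_sandwich a x b) <= opnorm a * matnorm n x * opnorm b
}.

#[short(type="operatorSpaceType")]
HB.structure Definition OperatorSpace (R : realType) :=
  {X of CompleteNormedModule R[i] X & isOperatorSpace R X}.
Arguments matnorm {R s} n _.

Section CompleteBoundedness.
Context {R : realType}.

(* sup_n || T_n : M_n(X) -> M_n(Y) ||, the matrix norms on X and Y being
   NX and NY. *)
Definition cbnorm_wrt (X Y : Type) (NX : forall n, 'M[X]_n -> R)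
    (NY : forall n, 'M[Y]_n -> R) (T : X -> Y) : \bar R :=
  ereal_sup [set r | exists n (x : 'M[X]_n),
    NX n x <= 1 /\ r = (NY n (map_mx T x))%:E].

Definition cbnorm (X Y : operatorSpaceType R) (T : X -> Y) : \bar R :=
  cbnorm_wrt (@matnorm R X) (@matnorm R Y) T.

Definition completely_bounded (X Y : operatorSpaceType R) (T : X -> Y) : Prop :=
  (cbnorm T < +oo)%E.

(* The matrix norms of the operator space M_n: M_m(M_n) = M_(m n). *)
Definition scalar_matnorm n m (B : 'M['M[R[i]]_n]_m) : R :=
  opnorm (\mxblock_(k < m, l < m) B k l).

(* The norm of M_n(Y^* ) = CB(Y, M_n): the matrix F of functionals is
   identified with the map y |-> (F i j y)_(i, j). *)
Definition dual_matnorm (Y : operatorSpaceType R) n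
    (F : 'M[Y -> R[i]^o]_n) : \bar R :=
  cbnorm_wrt (@matnorm R Y) (@scalar_matnorm n)
    (fun y => \matrix_(i, j) F i j y : 'M[R[i]]_n).

(* X = Y^* as operator spaces: x |-> pairing x is a linear map of X onto the
   bounded functionals on Y which is completely isometric (hence injective). *)
Record predual (X : operatorSpaceType R) := Predual {
  predual_space :> operatorSpaceType R ;
  pairing : {linear X -> (predual_space -> R[i]^o)} ;
  pairing_range : range pairing =
    [set f : predual_space -> R[i]^o | linear f /\ continuous f] ;
  pairing_isometric : forall n (x : 'M[X]_n),
    dual_matnorm (map_mx pairing x) = (matnorm n x)%:E
}.

End CompleteBoundedness.

Section Continuity.
Context {R : realType}.

Definition bounded_functional (X : operatorSpaceType R) :=
  {f : {linear X -> R[i]^o} | continuous f}.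

Definition weak_eval (X : operatorSpaceType R) (x : X) :
    prod_topology (fun _ : bounded_functional X => R[i]^o) :=
  fun f => sval f x.

Definition weakly_continuous (X : operatorSpaceType R) (T : topologicalType)
    (g : T -> X) : Prop :=
  continuous (g : T -> initial_topology (@weak_eval X)).

Definition weak_star_eval (X : operatorSpaceType R) (Y : predual X) (x : X) :
    prod_topology (fun _ : Y => R[i]^o) :=
  pairing Y x.

Definition weak_star_continuous (X : operatorSpaceType R) (Y : predual X)
    (T : topologicalType) (g : T -> X) : Prop :=
  continuous (g : T -> initial_topology (@weak_star_eval X Y)).

Definition separable (T : topologicalType) : Prop :=
  exists2 A : set T, countable A & dense A.

End Continuity.

(* A semigroup carrying a topology, with no compatibility required between the
   two: compatibility is expressed by the predicates below, and a bare semigroup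
   can be given any topology.  No separation axiom is assumed. *)
#[short(type="preTopologicalSemigroupType")]
HB.structure Definition PreTopologicalSemigroup :=
  {S of Semigroup S & Topological S}.

Definition left_topological_semigroup (S : preTopologicalSemigroupType) : Prop :=
  forall s : S, continuous (fun t : S => (s * t)%g).

Definition topological_group (S : preTopologicalSemigroupType) : Prop :=
  exists (e : S) (inv : S -> S),
    [/\ left_id e *%g /\ right_id e *%g,
        left_inverse e inv *%g /\ right_inverse e inv *%g,
        continuous (fun p : S * S => (p.1 * p.2)%g) &
        continuous inv].

Section Amenability.
Context {R : realType}.

Definition ltrans (S : semigroupType) (t : S) (f : S -> R[i]) : S -> R[i] :=
  fun s => f (t * s)%g.

(* The linear functional mu on the subspace T is represented by a function on
   all of S -> R[i] whose values outside T are irrelevant. *)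
Definition amenable_subspace (S : semigroupType) (T : set (S -> R[i])) : Prop :=
  exists mu : (S -> R[i]) -> R[i],
    [/\ forall (c : R[i]) f g, T f -> T g ->
          mu (fun s => c * f s + g s) = c * mu f + mu g,
        ereal_sup [set (normc (mu f))%:E | f in
          T `&` [set f | forall s, normc (f s) <= 1]] = 1%E,
        mu (cst 1) = 1 &
        forall t f, T f -> mu (ltrans t f) = mu f].

Definition bounded_functions (S : Type) : set (S -> R[i]) :=
  [set f | exists M : R, forall s, normc (f s) <= M].

(* The topology of {uniform S -> R[i]^o} is the one of the sup norm. *)
Definition left_uniformly_continuous_functions
    (S : preTopologicalSemigroupType) : set (S -> R[i]) :=
  [set f | [/\ bounded_functions f, continuous (f : S -> R[i]^o) &
    continuous (fun s => ltrans s f : {uniform S -> R[i]^o})]].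

End Amenability.

Definition amenable_semigroup (R : realType) (S : semigroupType) : Prop :=
  amenable_subspace (@bounded_functions R S).

Definition amenable_topological_group (R : realType)
    (S : preTopologicalSemigroupType) : Prop :=
  topological_group S /\
  amenable_subspace (@left_uniformly_continuous_functions R S).

Section OperatorSSpaces.
Context {R : realType}.

Definition operator_S_space (S : semigroupType) (X : operatorSpaceType R)
    (alpha : S -> {linear X -> X}) : Prop :=
  [/\ forall s t x, alpha (s * t)%g x = alpha s (alpha t x),
      forall s, completely_bounded (alpha s) &
      (ereal_sup (range (fun s => cbnorm (alpha s))) < +oo)%E].

(* preact s is the restriction of (alpha s)^* to the predual; preactE says that
   (alpha s)^* maps the predual into itself. *)
Record dual_operator_S_space (S : semigroupType) (X : operatorSpaceType R)
    (alpha : S -> {linear X -> X}) := DualOperatorSSpace {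
  predual_of :> predual X ;
  preact : S -> predual_of -> predual_of ;
  preactE : forall s (psi : predual_of) x,
    pairing predual_of x (preact s psi) = pairing predual_of (alpha s x) psi
}.

Definition fixed_points (S : semigroupType) (X : operatorSpaceType R)
    (alpha : S -> {linear X -> X}) : set X :=
  [set x | forall s, alpha s x = x].

End OperatorSSpaces.

Arguments preact {R S X alpha} d s psi.

(* Main.v *)
Require Import Defs.
From HB Require Import structures.
From mathcomp Require Import all_boot all_order all_algebra.
From mathcomp Require Import complex ring lra.
From mathcomp Require Import all_classical all_reals all_analysis.
Import Order.TTheory GRing.Theory Num.Theory.
Import numFieldNormedType.Exports.
Local Open Scope classical_set_scope.
Local Open Scope ring_scope.

(* A left invariant mean [mu] produces the projection by averaging the orbit maps:
   [phi (P x) = mu (s |-> phi (alpha_s x))] for all functionals [phi] (in the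
   predual, or bounded on [X]).  Invariance gives [alpha_t (P x) = P x], and the
   bound on [P] only uses [|mu f| <= sup |f|].  The work lies in the existence
   of [P x] or of [mu].
   - For dual spaces [P x] is a bounded functional on the predual; for a locally
     compact group, weak continuity of the predual action is upgraded to strong
     continuity, so that the coefficients are left uniformly continuous.
   - If the orbit is totally bounded, the orbit map is a uniform limit of simple
     functions, whose means lie in [X].  Weakly continuous orbits of compact
     groups are totally bounded, by a Baire category argument.
   - If [X] is separable and [S] compact, bounded functionals tending pointwise
     to [0] have means tending to [0], and a Hahn-Banach argument of Helly's type
     shows that [mu (s |-> phi (alpha_s x))] is evaluation at a point of [X].
   - A compact group carries a mean invariant on continuous functions, obtained
     as a limit of finite right averages with vanishing oscillation. *)

Set Implicit Arguments.
Unset Strict Implicit.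
Unset Printing Implicit Defensive.
Local Open Scope complex_scope.

(** * The complex Hahn-Banach theorem *)

(** Entrywise estimates would give [P] a bound growing with the matrix size. The constant in (i)
    survives because each matrix norm is tested through one quantity that commutes with the mean: a
    vector of $\ell^2$ in the dual case, a norming functional on $M_n(X)$ otherwise. Topologies on
    [S] need be neither metrizable nor Hausdorff: cluster points stand in for convergent
    subsequences, and the Baire argument runs inside a compact neighbourhood, along a countable
    set. *)

Section ComplexModulus.
Context {R : realType}.
Implicit Types z w : R[i].

Lemma normcRE z : `|z| = (normc z)%:C.
Proof. by case: z. Qed.

Lemma normc_ge0 z : 0 <= normc z.
Proof. by case: z => a b; exact: sqrtr_ge0. Qed.

Lemma normc_real (a : R) : normc a%:C = `|a|.
Proof. by rewrite /= expr0n addr0 sqrtr_sqr. Qed.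

Lemma normr_Re_le z : `|complex.Re z| <= normc z.
Proof. by case: z => a b /=; rewrite -sqrtr_sqr ler_wsqrtr // lerDl sqr_ge0. Qed.

Lemma normr_Im_le z : `|complex.Im z| <= normc z.
Proof. by case: z => a b /=; rewrite -sqrtr_sqr ler_wsqrtr // lerDr sqr_ge0. Qed.

Lemma Re_le_normc z : complex.Re z <= normc z.
Proof. exact: le_trans (ler_norm _) (normr_Re_le z). Qed.

Lemma ReD z w : complex.Re (z + w) = complex.Re z + complex.Re w.
Proof. by case: z; case: w. Qed.

Lemma ImD z w : complex.Im (z + w) = complex.Im z + complex.Im w.
Proof. by case: z; case: w. Qed.

Lemma normcN z : normc (- z) = normc z.
Proof. by case: z => a b /=; rewrite !sqrrN. Qed.

Lemma normcD z w : normc (z + w) <= normc z + normc w.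
Proof. exact: le_normcD. Qed.

Lemma normcB z w : normc (z - w) <= normc z + normc w.
Proof. by rewrite -(normcN w) normcD. Qed.

Lemma unimodular z : exists2 c : R[i], normc c = 1 & c * z = (normc z)%:C.
Proof.
have [->|z0] := eqVneq z 0.
  by exists 1; rewrite ?Normc.normc1 // mulr0 Normc.normc0.
have nz0 : normc z != 0.
  by apply: contra z0 => /eqP/Normc.eq0_normc ->.
exists ((normc z)%:C / z).
  rewrite Normc.normcM Normc.normcV normc_real ger0_norm ?normc_ge0 //.
  by rewrite divff.
by rewrite divfK.
Qed.

Lemma Re_bound_eq z : normc z <= complex.Re z -> z = (complex.Re z)%:C.
Proof.
case: z => a b /= h.
have a0 : 0 <= a by exact: le_trans (sqrtr_ge0 _) h.
have : a ^+ 2 + b ^+ 2 <= a ^+ 2.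
  by rewrite -[leLHS]sqr_sqrtr ?addr_ge0 ?sqr_ge0 // ler_pXn2r ?nnegrE ?sqrtr_ge0.
rewrite gerDl => b0.
have /eqP : b ^+ 2 == 0 by rewrite eq_le b0 sqr_ge0.
by move=> /eqP; rewrite sqrf_eq0 => /eqP ->.
Qed.

End ComplexModulus.

Section HahnBanach.
Context {R : realType} (V : lmodType R[i]) (p : V -> R).
Hypothesis pD : forall u v, p (u + v) <= p u + p v.
Hypothesis pZ : forall (c : R[i]) u, p (c *: u) = normc c * p u.

Let p0 : p 0 = 0.
Proof. by rewrite -(scale0r 0) pZ Normc.normc0 mul0r. Qed.

Let pZr (t : R) u : p (t%:C *: u) = `|t| * p u.
Proof. by rewrite pZ normc_real. Qed.

Let dominated (G : set (V * R)) := [/\ forall x y, G x -> G y -> G (x + y),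
  forall (t : R) x, G x -> G (t%:C *: x.1, t * x.2) &
  forall x, G x -> x.2 <= p x.1].

Let dominated_extend (G : set (V * R)) (w : V) : dominated G -> G !=set0 ->
  exists2 G', dominated G' & G `<=` G' /\ exists a, G' (w, a).
Proof.
move=> [GD GZ Gp] [g0 Gg0].
have G0 : G 0.
  have := GZ 0 _ Gg0; rewrite mul0r.
  by rewrite [X in G (X, _)](_ : _ = 0) // -[LHS]/(0%:C *: _) scale0r.
(* The value [c] at [w] must lie above every [x.2 - p (x.1 - w)] and below every
   [p (y.1 + w) - y.2]; [bd] compares the two families, and the supremum of the first serves as
   [c]. *)
pose A := [set x.2 - p (x.1 - w) | x in G].
have bd x y : G x -> G y -> x.2 - p (x.1 - w) <= p (y.1 + w) - y.2.
  move=> Gx Gy.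
  have h1 := Gp _ (GD _ _ Gx Gy).
  have h2 := pD (x.1 - w) (y.1 + w).
  have e : x.1 - w + (y.1 + w) = (x + y).1 by rewrite addrACA addNr addr0.
  rewrite e in h2; have h3 := le_trans h1 h2; rewrite /= in h3; lra.
have hA : has_sup A.
  split; first by exists (g0.2 - p (g0.1 - w)); exists g0.
  exists (p (g0.1 + w) - g0.2) => _ [x Gx <-]; exact: bd.
pose c := sup A.
have c1 x : G x -> x.2 - c <= p (x.1 - w).
  move=> Gx; have : x.2 - p (x.1 - w) <= c by apply: ub_le_sup; [case: hA | exists x].
  lra.
have c2 x : G x -> x.2 + c <= p (x.1 + w).
  move=> Gx; have : c <= p (x.1 + w) - x.2.
    by apply: ge_sup; [case: hA | move=> _ [y Gy <-]; exact: bd].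
  lra.
exists [set z | exists x (t : R), G x /\ z = (x.1 + t%:C *: w, x.2 + t * c)].
  split.
  - move=> _ _ [x [t [Gx ->]]] [y [s [Gy ->]]]; exists (x + y), (t + s).
    split; first exact: GD.
    by rewrite /= rmorphD /= scalerDl mulrDl; congr (_, _) => /=; rewrite addrACA.
  - move=> s _ [x [t [Gx ->]]]; exists (s%:C *: x.1, s * x.2), (s * t).
    split; first exact: GZ.
    by rewrite /= scalerDr scalerA rmorphM /= mulrDr mulrA.
  - move=> _ [x [t [Gx ->]]] /=.
    case: (ltrgtP t 0) => [t0|t0|->]; last by rewrite scale0r addr0 mul0r addr0; exact: Gp.
    + have e : x.1 + t%:C *: w = (- t)%:C *: ((- t^-1)%:C *: x.1 - w).
        rewrite scalerBr scalerA -rmorphM /= mulrNN divff ?lt_eqF //= scale1r.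
        by rewrite rmorphN /= scaleNr opprK.
      rewrite e pZr normrN ltr0_norm //.
      have := c1 _ (GZ (- t^-1) _ Gx); rewrite /= => h.
      have := ler_wpM2l (_ : 0 <= - t) h; rewrite oppr_ge0 => /(_ (ltW t0)).
      apply: le_trans; rewrite mulrBr mulrA mulrNN divff ?lt_eqF // mul1r.
      by rewrite mulNr opprK.
    + have e : x.1 + t%:C *: w = t%:C *: ((t^-1)%:C *: x.1 + w).
        by rewrite scalerDr scalerA -rmorphM /= divff ?gt_eqF //= scale1r.
      rewrite e pZr gtr0_norm //.
      have := c2 _ (GZ (t^-1) _ Gx); rewrite /= => h.
      have := ler_wpM2l (ltW t0) h.
      by apply: le_trans; rewrite mulrDr mulrA divff ?gt_eqF // mul1r.
split.
  move=> x Gx; exists x, 0; split=> //.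
  by rewrite scale0r mul0r !addr0; case: x {Gx}.
exists c; exists 0, 1; split=> //=.
by rewrite scale1r !add0r mul1r.
Qed.

(* The functional is produced as the graph of a real-linear map, by Zorn's
   lemma, and complexified as [f v - i f (i v)]. *)
Theorem hahn_banach (v0 : V) : exists f : {linear V -> R[i]^o},
  (forall v, normc (f v) <= p v) /\ f v0 = (p v0)%:C.
Proof.
pose G0 : set (V * R) := [set (t%:C *: v0, t * p v0) | t in [set: R]].
have dG0 : dominated G0.
  split.
  - move=> _ _ [t _ <-] [s _ <-]; exists (t + s) => //.
    by rewrite rmorphD /= scalerDl mulrDl.
  - by move=> s _ [t _ <-]; exists (s * t) => //=; rewrite rmorphM /= scalerA mulrA.
  - move=> _ [t _ <-] /=; rewrite pZr ler_wpM2r ?ler_norm //.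
    have := pD v0 (- v0); rewrite subrr p0 -scaleN1r pZ.
    rewrite normcN Normc.normc1 mul1r; lra.
have [G [[dG G0G] Gmax]] : exists G, (dominated G /\ G0 `<=` G) /\
    forall B, (dominated B /\ G0 `<=` B) -> G `<=` B -> B `<=` G.
  have [|G [PG mG]] := @Zorn_bigcup _ [set G | G = set0 \/ (dominated G /\ G0 `<=` G)].
  - move=> F FP tot.
    have [Fne|] := pselect (exists B, F B /\ B !=set0); last first.
      move=> Fne; left; rewrite -subset0 => x [B FB Bx]; case: Fne.
      by exists B; split=> //; exists x.
    have [B0 [FB0 B0ne]] := Fne.
    have ok B : F B -> B !=set0 -> dominated B /\ G0 `<=` B.
      move=> FB [x Bx]; case: (FP _ FB) => // B0'.
      by move: Bx; rewrite B0'.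
    right; split; last first.
      by move=> x /(ok _ FB0 B0ne).2 ?; exists B0.
    split.
    + move=> x y [B FB Bx] [C FC Cy].
      have [dB _] := ok _ FB (ex_intro _ _ Bx).
      have [dC _] := ok _ FC (ex_intro _ _ Cy).
      have [BC|CB] := tot _ _ FB FC.
        by exists C => //; case: dC => + _ _; apply => //; exact: BC.
      by exists B => //; case: dB => + _ _; apply => //; exact: CB.
    + move=> t x [B FB Bx]; exists B => //.
      by have [[_ + _] _] := ok _ FB (ex_intro _ _ Bx); exact.
    + move=> x [B FB Bx].
      by have [[_ _ +] _] := ok _ FB (ex_intro _ _ Bx); exact.
  - have G0ne : G0 (0%:C *: v0, 0 * p v0) by exists 0.
    have Gne : G !=set0.
      apply/set0P/eqP => G_0; subst G.
      apply: (mG G0); last by right; split.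
      by split; [exact: sub0set | move=> /(_ _ G0ne)].
    case: PG => [PG|PG]; first by case: Gne => x; rewrite PG.
    exists G; split=> // B PB GB; apply: contrapT => BG.
    by apply: (mG B); [split | right].
have Gne : G !=set0.
  by exists (0%:C *: v0, 0 * p v0); apply: G0G; exists 0.
have total w : exists a, G (w, a).
  have [G' dG' [GG' [a G'a]]] := @dominated_extend G w dG Gne.
  exists a; apply: (Gmax G' _ GG') => //.
  by split=> // x /G0G /GG'.
have [GD GZ Gp] := dG.
have uniq w a b : G (w, a) -> G (w, b) -> a = b.
  move=> Ga Gb.
  suff h (a' b' : R) : G (w, a') -> G (w, b') -> a' <= b'.
    by apply/eqP; rewrite eq_le !h.
  move=> Ga' Gb'.
  have := GD _ _ Ga' (GZ (-1) _ Gb') => /Gp /=.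
  by rewrite rmorphN1 scaleN1r subrr p0 mulN1r subr_le0.
pose f w := sval (cid (total w)).
have fG w : G (w, f w) by exact: svalP (cid (total w)).
have fD u v : f (u + v) = f u + f v.
  exact: (uniq (u + v)) (fG _) (GD _ _ (fG u) (fG v)).
have fZ (t : R) u : f (t%:C *: u) = t * f u.
  exact: (uniq (t%:C *: u)) (fG _) (GZ t _ (fG u)).
have fp w : f w <= p w := Gp _ (fG w).
have fv0 : f v0 = p v0.
  apply: (uniq v0 _ _ (fG _)); apply: G0G; exists 1 => //.
  by rewrite scale1r mul1r.
pose F v : R[i]^o := f v -i* f ('i *: v).
have FE v : F v = (f v)%:C - 'i * (f ('i *: v))%:C.
  by rewrite /F /=; simpc.
have Flin : linear F.
  have fN u : f (- u) = - f u by rewrite -mulN1r -fZ rmorphN1 scaleN1r.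
  move=> [a b] u v.
  have e w : (a +i* b) *: w = a%:C *: w + b%:C *: ('i *: w).
    by rewrite scalerA -scalerDl; congr (_ *: _); simpc.
  have e2 w : 'i *: ((a +i* b) *: w) = a%:C *: ('i *: w) - b%:C *: w.
    rewrite !scalerA -scalerBl; congr (_ *: _).
    by simpc.
  rewrite /F scalerDr e2 e !fD !fN !fZ.
  rewrite -[RHS]/((a +i* b) * (f u -i* f ('i *: u)) + (f v -i* f ('i *: v))).
  by simpc; congr (_ +i* _); ring.
pose FL : {linear V -> R[i]^o} :=
  HB.pack F (GRing.isLinear.Build _ _ _ _ F Flin).
(* Rotating [v] makes [F v] real, hence a value of [f], and [p] does not see the rotation. *)
have Fb v : normc (F v) <= p v.
  have [c c1 cF] := unimodular (F v : R[i]).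
  have : FL (c *: v) = (normc (F v))%:C by rewrite linearZ.
  move=> /(congr1 (@complex.Re R)) /= <-.
  by apply: le_trans (fp _) _; rewrite pZ c1 mul1r.
exists FL; split=> //.
have h : normc (F v0) <= complex.Re (F v0 : R[i]) by rewrite [leRHS]fv0; exact: Fb.
by rewrite -fv0; exact: (Re_bound_eq h).
Qed.

End HahnBanach.

(** * Scalar matrices and means *)

Section ScalarMatrixNorms.
Context {R : realType}.

Lemma conjc_mul_normc (z : R[i]) : z^* * z = (normc z ^+ 2)%:C.
Proof. by rewrite mulrC -complex.sqr_normc normcRE rmorphXn. Qed.

Lemma normc_sum (I : Type) (r : seq I) (P : pred I) (F : I -> R[i]) :
  normc (\sum_(i <- r | P i) F i) <= \sum_(i <- r | P i) normc (F i).
Proof.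
elim/big_rec2: _ => [|i y x _ h]; first by rewrite Normc.normc0.
by apply: le_trans (normcD _ _) _; rewrite lerD2l.
Qed.

Lemma l2norm_ge0 n (v : 'cV[R[i]]_n) : 0 <= l2norm v.
Proof. exact: sqrtr_ge0. Qed.

Lemma sqr_l2norm n (v : 'cV[R[i]]_n) : l2norm v ^+ 2 = \sum_i normc (v i 0) ^+ 2.
Proof. by rewrite sqr_sqrtr // sumr_ge0 // => i _; exact: sqr_ge0. Qed.

Lemma l2norm0 n : l2norm (0 : 'cV[R[i]]_n) = 0.
Proof.
rewrite /l2norm big1 ?sqrtr0 // => i _.
by rewrite mxE Normc.normc0 expr0n.
Qed.

Lemma normc_le_l2norm n (v : 'cV[R[i]]_n) i : normc (v i 0) <= l2norm v.
Proof.
rewrite -(@ler_pXn2r _ 2) ?nnegrE ?normc_ge0 ?l2norm_ge0 // sqr_l2norm.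
by rewrite (bigD1 i) //= lerDl sumr_ge0 // => j _; exact: sqr_ge0.
Qed.

Lemma l2norm_le_sum n (v : 'cV[R[i]]_n) : l2norm v <= \sum_i normc (v i 0).
Proof.
have s0 : 0 <= \sum_i normc (v i 0) by apply: sumr_ge0 => i _; exact: normc_ge0.
rewrite -(@ler_pXn2r _ 2) ?nnegrE ?l2norm_ge0 // sqr_l2norm expr2 mulr_suml.
apply: ler_sum => i _; rewrite expr2 ler_wpM2l ?normc_ge0 //.
by rewrite (bigD1 i) //= lerDl sumr_ge0 // => j _; exact: normc_ge0.
Qed.

Lemma opnorm_le m n (a : 'M[R[i]]_(m, n)) (C : R) :
  (forall v, l2norm v <= 1 -> l2norm (a *m v) <= C) -> opnorm a <= C.
Proof.
move=> h; apply: ge_sup; last by move=> _ [v v1 <-]; exact: h.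
by exists (l2norm (a *m 0)); exists 0 => //=; rewrite l2norm0.
Qed.

Lemma le_opnorm m n (a : 'M[R[i]]_(m, n)) v :
  l2norm v <= 1 -> l2norm (a *m v) <= opnorm a.
Proof.
move=> v1; apply: ub_le_sup; last by exists v.
exists (\sum_i \sum_j normc (a i j)) => _ [w w1 <-].
apply: le_trans (l2norm_le_sum _) _; apply: ler_sum => i _; rewrite mxE.
apply: le_trans (normc_sum _ _ _) _; apply: ler_sum => j _.
rewrite Normc.normcM ler_piMr ?normc_ge0 //.
exact: le_trans (normc_le_l2norm _ _) w1.
Qed.

Lemma opnorm_ge0 m n (a : 'M[R[i]]_(m, n)) : 0 <= opnorm a.
Proof.
by apply: le_trans (l2norm_ge0 _) (@le_opnorm _ _ a 0 _); rewrite l2norm0.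
Qed.

Lemma entry_le_opnorm m n (a : 'M[R[i]]_(m, n)) i j : normc (a i j) <= opnorm a.
Proof.
have e1 : l2norm (delta_mx j 0 : 'cV[R[i]]_n) <= 1.
  apply: le_trans (l2norm_le_sum _) _; rewrite (bigD1 j) //= mxE !eqxx.
  rewrite Normc.normc1 big1 ?addr0 // => k kj.
  by rewrite mxE (negbTE kj) Normc.normc0.
apply: le_trans (le_opnorm a e1).
by rewrite -colE; apply: le_trans (normc_le_l2norm _ i); rewrite mxE.
Qed.

End ScalarMatrixNorms.

Section Means.
Context {R : realType} {S : Type}.
Implicit Types (T : set (S -> R[i])) (mu : (S -> R[i]) -> R[i]).

Definition unital_subspace T := T (cst 1) /\
  forall (c : R[i]) f g, T f -> T g -> T (fun s => c * f s + g s).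

Definition mean_on T mu := [/\ forall (c : R[i]) f g, T f -> T g ->
    mu (fun s => c * f s + g s) = c * mu f + mu g,
  forall f (C : R), T f -> (forall s, normc (f s) <= C) -> normc (mu f) <= C &
  mu (cst 1) = 1].

Section MeanTheory.
Variables (T : set (S -> R[i])) (mu : (S -> R[i]) -> R[i]).
Hypotheses (TT : unital_subspace T) (mm : mean_on T mu).

Lemma subspace0 : T (cst 0).
Proof.
case: TT => T1 TL; have := TL (-1) _ _ T1 T1.
by rewrite [X in T X](_ : _ = cst 0) //; apply/funext => s /=; rewrite mulr1 addNr.
Qed.

Lemma subspaceZ (c : R[i]) f : T f -> T (fun s => c * f s).
Proof.
move=> Tf; have := TT.2 c _ _ Tf subspace0.
by rewrite [X in T X](_ : _ = (fun s => c * f s)) //; apply/funext => s /=; rewrite addr0.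
Qed.

Lemma subspace_const (c : R[i]) : T (fun=> c).
Proof.
have := subspaceZ c TT.1.
by rewrite [X in T X](_ : _ = fun=> c) //; apply/funext => s /=; rewrite mulr1.
Qed.

Lemma subspaceD f g : T f -> T g -> T (fun s => f s + g s).
Proof.
move=> Tf Tg; have := TT.2 1 _ _ Tf Tg.
by rewrite [X in T X](_ : _ = (fun s => f s + g s)) //; apply/funext => s; rewrite mul1r.
Qed.

Lemma subspace_sum (I : Type) (r : seq I) (F : I -> S -> R[i]) :
  (forall i, T (F i)) -> T (fun s => \sum_(i <- r) F i s).
Proof.
move=> TF; elim: r => [|i r IH].
  by under eq_fun do rewrite big_nil; exact: subspace0.
by under eq_fun do rewrite big_cons; exact: subspaceD.
Qed.

Lemma mean0 : mu (cst 0) = 0.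
Proof.
case: mm => mL _ _; have := mL 1 _ _ subspace0 subspace0.
rewrite [X in mu X](_ : _ = cst 0); last by apply/funext => s /=; rewrite mulr0 addr0.
by rewrite mul1r => /eqP; rewrite addrC -subr_eq subrr => /eqP.
Qed.

Lemma meanZ (c : R[i]) f : T f -> mu (fun s => c * f s) = c * mu f.
Proof.
move=> Tf; case: mm => mL _ _; have := mL c _ _ Tf subspace0.
rewrite mean0 addr0 => <-; congr mu.
by apply/funext => s /=; rewrite addr0.
Qed.

Lemma mean_const (c : R[i]) : mu (fun=> c) = c.
Proof.
case: mm => _ _ m1; rewrite -[RHS]mulr1 -m1 -meanZ; last exact: TT.1.
by congr mu; apply/funext => s /=; rewrite mulr1.
Qed.

Lemma meanD f g : T f -> T g -> mu (fun s => f s + g s) = mu f + mu g.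
Proof.
move=> Tf Tg; case: mm => mL _ _; rewrite -[mu f]mul1r -mL //.
by congr mu; apply/funext => s; rewrite mul1r.
Qed.

Lemma mean_sum (I : Type) (r : seq I) (F : I -> S -> R[i]) :
  (forall i, T (F i)) -> mu (fun s => \sum_(i <- r) F i s) = \sum_(i <- r) mu (F i).
Proof.
move=> TF; elim: r => [|i r IH].
  by under eq_fun do rewrite big_nil; rewrite big_nil; exact: mean0.
under eq_fun do rewrite big_cons.
by rewrite big_cons meanD ?IH //; exact: subspace_sum.
Qed.

Lemma mean_nonempty : exists s : S, True.
Proof.
apply: contrapT => nS; case: mm => _ mb m1.
have : normc (mu (cst 1)) <= 0.
  by apply: mb => [|s]; [exact: TT.1 | case: nS; exists s].
by rewrite m1 Normc.normc1 ler10.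
Qed.

(** With [w] the vector of means, [l2norm w ^+ 2] is the mean of the inner products of [w] with
    [W s], whose moduli are at most [(l2norm w ^+ 2 + C ^+ 2) / 2] by the arithmetic-geometric mean
    inequality. The bound does not depend on [n], as complete boundedness requires. *)
Lemma mean_l2norm n (W : S -> 'cV[R[i]]_n) (C : R) :
  (forall i, T (fun s => W s i 0)) -> (forall s, l2norm (W s) <= C) ->
  l2norm (\col_i mu (fun s => W s i 0)) <= C.
Proof.
move=> TW WC; set w := \col_i _.
have [s0 _] := mean_nonempty.
have C0 : 0 <= C := le_trans (l2norm_ge0 _) (WC s0).
have e : mu (fun s => \sum_i (w i 0)^* * W s i 0) = (l2norm w ^+ 2)%:C.
  rewrite mean_sum => [|i]; last exact: subspaceZ.
  rewrite sqr_l2norm rmorph_sum; apply: eq_bigr => i _.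
  rewrite meanZ //; apply: etrans (conjc_mul_normc (w i 0)); congr (_ * _); rewrite [RHS]mxE.
  by [].
have : normc (mu (fun s => \sum_i (w i 0)^* * W s i 0)) <= (l2norm w ^+ 2 + C ^+ 2) / 2.
  case: mm => _ mb _; apply: mb => [|s].
    by apply: subspace_sum => i; exact: subspaceZ.
  apply: le_trans (normc_sum _ _ _) _.
  rewrite ler_pdivlMr ?ltr0n //; apply: (@le_trans _ _ (l2norm w ^+ 2 + l2norm (W s) ^+ 2)).
    rewrite !sqr_l2norm -big_split /= mulr_suml; apply: ler_sum => i _.
    have -> : normc ((w i 0)^* * W s i 0) = normc (w i 0) * normc (W s i 0).
      by rewrite Normc.normcM; congr (_ * _); case: (w i 0) => a b /=; rewrite sqrrN.
    rewrite -subr_ge0.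
    have := sqr_ge0 (normc (w i 0) - normc (W s i 0)); lra.
  by rewrite lerD2l ler_pXn2r ?nnegrE ?l2norm_ge0.
rewrite e normc_real ger0_norm ?sqr_ge0 // => h.
rewrite -(@ler_pXn2r _ 2) ?nnegrE ?l2norm_ge0 //; lra.
Qed.

End MeanTheory.

End Means.

(** The bound on the unit ball is rescaled to a sup bound; since [C] may be [0], this is done for
    [D > C], and [D] is let tend to [C]. *)
Lemma amenable_mean (R : realType) (S : semigroupType) (T : set (S -> R[i])) :
  unital_subspace T -> amenable_subspace T -> exists2 mu, mean_on T mu &
    forall t f, T f -> mu (ltrans t f) = mu f.
Proof.
move=> TT [mu [mL mb m1 mI]]; exists mu => //; split=> // f C Tf fC.
have [s0] : exists s : S, True.
  apply: contrapT => nS.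
  (* On an empty semigroup [1 + 1] and [1] are the same function, and linearity would force the mean
     of [1] to be [0]. *)
  have e1 : (fun s : S => 1 * cst 1 s + cst 1 s) = cst 1 :> (S -> R[i]).
    by apply/funext => s; case: nS; exists s.
  have := mL 1 _ _ TT.1 TT.1; rewrite e1 m1 => /eqP.
  by rewrite mul1r addrC -subr_eq subrr eq_sym oner_eq0.
have C0 : 0 <= C := le_trans (normc_ge0 _) (fC s0).
move=> _; have mu0 : mu (cst 0) = 0.
  have T0 := subspace0 TT; have := mL 1 _ _ T0 T0.
  rewrite [X in mu X](_ : _ = cst 0); last by apply/funext => s /=; rewrite mulr0 addr0.
  by rewrite mul1r => /eqP; rewrite addrC -subr_eq subrr => /eqP.
have bd (D : R) : 0 < D -> (forall s, normc (f s) <= D) -> normc (mu f) <= D.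
  move=> D0 fD.
  have Tg : T (fun s => (D^-1)%:C * f s) by exact: subspaceZ.
  have : ((normc (mu (fun s => (D^-1)%:C * f s)))%:E <= 1)%E.
    rewrite -mb; apply: ereal_sup_ubound; exists (fun s => (D^-1)%:C * f s) => //.
    split=> // s; rewrite Normc.normcM normc_real gtr0_norm ?invr_gt0 //.
    by rewrite ler_pdivrMl // mulr1.
  have -> : mu (fun s => (D^-1)%:C * f s) = (D^-1)%:C * mu f.
    have := mL (D^-1)%:C _ _ Tf (subspace0 TT); rewrite mu0 addr0 => <-.
    by congr mu; apply/funext => s /=; rewrite addr0.
  rewrite lee_fin Normc.normcM normc_real gtr0_norm ?invr_gt0 //.
  by rewrite ler_pdivrMl // mulr1.
apply/ler_addgt0Pr => e e0; apply: bd => [|s]; first by rewrite ltr_wpDl.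
by apply: le_trans (fC s) _; rewrite lerDl ltW.
Qed.

Lemma unital_bounded (R : realType) (S : Type) :
  unital_subspace (@bounded_functions R S).
Proof.
split; first by exists 1 => s; rewrite Normc.normc1.
move=> c f g [M fM] [N gN]; exists (normc c * M + N) => s.
apply: le_trans (normcD _ _) _; rewrite Normc.normcM lerD //.
by rewrite ler_wpM2l ?normc_ge0.
Qed.

(** * Operator spaces and their preduals *)

Section OperatorSpaceNorms.
Context {R : realType}.
Implicit Types X Y : operatorSpaceType R.

Definition nrm X (x : X) : R := matnorm 1 (const_mx x).

Lemma normE X (x : X) : `|x| = (nrm x)%:C.
Proof. by rewrite -matnorm1E. Qed.

Lemma matnorm0 X n : matnorm n (0 : 'M[X]_n) = 0.
Proof.
have := @matnormZ R X n 0 0; rewrite Normc.normc0 mul0r => <-.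
by congr matnorm; apply/matrixP => i j; rewrite !mxE scale0r.
Qed.

Lemma matnorm_ge0 X n (x : 'M[X]_n) : 0 <= matnorm n x.
Proof.
have := matnormD _ x (map_mx ( *:%R (-1)) x).
rewrite matnormZ normcN Normc.normc1 mul1r.
rewrite (_ : x + _ = 0) ?matnorm0; first by lra.
by apply/matrixP => i j; rewrite !mxE scaleN1r subrr.
Qed.

Lemma nrm_ge0 X (x : X) : 0 <= nrm x.
Proof. exact: matnorm_ge0. Qed.

Lemma nrmD X (x y : X) : nrm (x + y) <= nrm x + nrm y.
Proof.
apply: le_trans (matnormD _ _ _); rewrite le_eqVlt; apply/orP; left; apply/eqP.
by congr matnorm; apply/matrixP => i j; rewrite !mxE.
Qed.

Lemma nrmZ X (c : R[i]) (x : X) : nrm (c *: x) = normc c * nrm x.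
Proof. by rewrite -matnormZ map_const_mx. Qed.

Lemma nrmN X (x : X) : nrm (- x) = nrm x.
Proof. by rewrite -scaleN1r nrmZ normcN Normc.normc1 mul1r. Qed.

Lemma nrm0 X : nrm (0 : X) = 0.
Proof. by rewrite -(scale0r 0) nrmZ Normc.normc0 mul0r. Qed.

Lemma nrm_eq0 X (x : X) : nrm x = 0 -> x = 0.
Proof. by move=> /matnorm_eq0/matrixP/(_ 0 0); rewrite !mxE. Qed.

Lemma nrmB X (x y : X) : nrm (x - y) = nrm (y - x).
Proof. by rewrite -nrmN opprB. Qed.

Lemma continuous_functionalP X (f : {linear X -> R[i]^o}) :
  continuous f <-> exists2 K : R, 0 <= K & forall x, normc (f x) <= K * nrm x.
Proof.
rewrite -linear_bounded_continuous linear_boundedP; split.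
  move=> /pinfty_ex_gt0 [M M0 MP].
  have /complex_realP[K MK] := gtr0_real M0; subst M.
  exists K => [|x]; first by rewrite -ler0c ltW.
  by have := MP x; rewrite normE -rmorphM /= normcRE lecR.
move=> [K K0 KP]; exists K%:C; split.
  by apply/complex_realP; exists K.
move=> M KM x; apply: (@le_trans _ _ (K%:C * `|x|)); last first.
  by rewrite ler_wpM2r // ltW.
by rewrite normE -rmorphM /= [leLHS]normcRE lecR.
Qed.

Lemma matnorm_map_le X Y (T : {linear X -> Y}) (C : R) n :
  (forall x : 'M[X]_n, matnorm n x <= 1 -> matnorm n (map_mx T x) <= C) ->
  forall x : 'M[X]_n, matnorm n (map_mx T x) <= C * matnorm n x.
Proof.
move=> h x; have [x0|x0] := eqVneq (matnorm n x) 0.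
  rewrite x0 mulr0 (matnorm_eq0 _ _ x0).
  rewrite (_ : map_mx T 0 = 0) ?matnorm0 //.
  by apply/matrixP => i j; rewrite !mxE linear0.
have xp : 0 < matnorm n x by rewrite lt_def x0 matnorm_ge0.
pose c := (matnorm n x)^-1.
have cn : normc c%:C = c by rewrite normc_real gtr0_norm // invr_gt0.
have := h (map_mx ( *:%R c%:C) x); rewrite matnormZ cn mulVf // lexx => /(_ isT).
rewrite (_ : map_mx T _ = map_mx ( *:%R c%:C) (map_mx T x)); last first.
  by apply/matrixP => i j; rewrite !mxE linearZ.
by rewrite matnormZ cn ler_pdivrMl // mulrC.
Qed.

Lemma cbnorm_le X Y (T : X -> Y) (C : R) :
  (forall n (x : 'M[X]_n), matnorm n x <= 1 -> matnorm n (map_mx T x) <= C) ->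
  (cbnorm T <= C%:E)%E.
Proof.
by move=> h; apply: ge_ereal_sup => _ [n [x [x1 ->]]]; rewrite lee_fin h.
Qed.

Lemma cbnorm_ge0 X Y (T : {linear X -> Y}) : (0 <= cbnorm T)%E.
Proof.
apply: ereal_sup_ubound; exists 0, 0; split; first by rewrite matnorm0.
rewrite (_ : map_mx T 0 = 0) ?matnorm0 //.
by apply/matrixP => i j; rewrite !mxE linear0.
Qed.

Lemma le_cbnorm X Y (T : {linear X -> Y}) (C : R) : (cbnorm T <= C%:E)%E ->
  forall n (x : 'M[X]_n), matnorm n (map_mx T x) <= C * matnorm n x.
Proof.
move=> TC n; apply: matnorm_map_le => x x1; rewrite -lee_fin.
by apply: le_trans TC; apply: ereal_sup_ubound; exists n, x.
Qed.

End OperatorSpaceNorms.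

Section Actions.
Context {R : realType} {S : semigroupType} {X : operatorSpaceType R}.
Variable alpha : S -> {linear X -> X}.
Hypothesis alphaS : operator_S_space alpha.

Definition has_projection := exists P : {linear X -> X},
    [/\ completely_bounded P /\
        (cbnorm P <= ereal_sup (range (fun s => cbnorm (alpha s))))%E,
        range P = fixed_points alpha &
        P \o P = P].

(** Nonemptiness makes the supremum a nonnegative real; over an empty family [ereal_sup] is
    [-oo]. *)
Lemma action_bound : (exists s : S, True) -> exists C : R,
  [/\ 0 <= C, ereal_sup (range (fun s => cbnorm (alpha s))) = C%:E &
      forall s n (x : 'M[X]_n), matnorm n (map_mx (alpha s) x) <= C * matnorm n x].
Proof.
move=> [s0 _]; case: alphaS => _ _ Cfin.
set E := ereal_sup _ in Cfin *.
have leE s : (cbnorm (alpha s) <= E)%E by apply: ereal_sup_ubound; exists s.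
have E0 : (0 <= E)%E := le_trans (cbnorm_ge0 _) (leE s0).
have Efin : E \is a fin_num by rewrite ge0_fin_numE.
exists (fine E); split; [exact: fine_ge0 | by rewrite fineK |].
by move=> s; apply: le_cbnorm; rewrite fineK.
Qed.

Lemma action_nrm (C : R) :
  (forall s n (x : 'M[X]_n), matnorm n (map_mx (alpha s) x) <= C * matnorm n x) ->
  forall s x, nrm (alpha s x) <= C * nrm x.
Proof. by move=> h s x; have := h s 1%N (const_mx x); rewrite map_const_mx. Qed.

Lemma projectionI (P : {linear X -> X}) (C : R) :
  ereal_sup (range (fun s => cbnorm (alpha s))) = C%:E ->
  (forall n (x : 'M[X]_n), matnorm n x <= 1 -> matnorm n (map_mx P x) <= C) ->
  (forall t x, alpha t (P x) = P x) ->
  (forall x, (forall t, alpha t x = x) -> P x = x) -> has_projection.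
Proof.
move=> EC PC aP Pfix; have cbP : (cbnorm P <= C%:E)%E by exact: cbnorm_le.
exists P; split; first split.
- by apply: le_lt_trans cbP _; rewrite ltry.
- by rewrite EC.
- apply/seteqP; split => [_ [x _ <-] t|x xfix]; first exact: aP.
  by exists x => //; exact: Pfix.
- by apply/funext => x /=; rewrite Pfix.
Qed.

End Actions.

Section Duality.
Context {R : realType} {X : operatorSpaceType R} (D : predual X).

Definition pairing_mx n (x : 'M[X]_n) (psi : D) : 'M[R[i]]_n :=
  \matrix_(i, j) pairing D (x i j) psi.

Lemma predual_matnormP n (x : 'M[X]_n) (C : R) : matnorm n x <= C <->
  forall m (y : 'M[D]_m), matnorm m y <= 1 ->
    scalar_matnorm (map_mx (pairing_mx x) y) <= C.
Proof.
have e m (y : 'M[D]_m) : map_mx (fun y0 => \matrix_(i, j) map_mx (pairing D) x i j y0) y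
    = map_mx (pairing_mx x) y.
  by apply/matrixP => k l; rewrite !mxE; apply/matrixP => i j; rewrite !mxE.
rewrite -lee_fin -(pairing_isometric D); split => [h m y y1|h].
  rewrite -lee_fin; apply: le_trans h; apply: ereal_sup_ubound.
  by exists m, y; rewrite e.
by apply: ge_ereal_sup => _ [m [y [y1 ->]]]; rewrite e lee_fin h.
Qed.

Lemma pairing_linear (x : X) : linear (pairing D x : D -> R[i]^o).
Proof.
have : range (pairing D) (pairing D x) by exists x.
by rewrite (pairing_range D) => -[].
Qed.

Lemma pairingZ (x : X) (c : R[i]) psi : pairing D x (c *: psi) = c * pairing D x psi.
Proof.
have h0 : pairing D x 0 = 0.
  have := pairing_linear x (-1) 0 0; rewrite scaler0 addr0.
  by rewrite scaleN1r addNr.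
have := pairing_linear x c psi 0; rewrite h0 !addr0 //.
Qed.

Lemma pairing_bound (x : X) (psi : D) : normc (pairing D x psi) <= nrm x * nrm psi.
Proof.
have key (y : D) : nrm y <= 1 -> normc (pairing D x y) <= nrm x.
  move=> y1; have [/(_ (lexx _) 1%N (const_mx y) y1) h _] :=
    predual_matnormP (const_mx x : 'M[X]_1) (nrm x).
  pose i0 := @tagnat.Rank 1 (fun=> 1%N) ord0 ord0.
  apply: le_trans h; apply: le_trans (entry_le_opnorm _ i0 i0).
  by rewrite !mxE.
have [y0|y0] := eqVneq (nrm psi) 0.
  by rewrite (nrm_eq0 y0) -(scale0r 0) pairingZ mul0r Normc.normc0 mulr_ge0 ?nrm_ge0.
have yp : 0 < nrm psi by rewrite lt_def y0 nrm_ge0.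
pose c := (nrm psi)^-1.
have cn : normc c%:C = c by rewrite normc_real gtr0_norm // invr_gt0.
have := key (c%:C *: psi); rewrite nrmZ cn mulVf // lexx => /(_ isT).
by rewrite pairingZ Normc.normcM cn ler_pdivrMl // mulrC.
Qed.

Lemma pairing_inj : injective (pairing D).
Proof.
move=> x y xy; apply/eqP; rewrite -subr_eq0; apply/eqP/nrm_eq0.
apply/eqP; rewrite eq_le nrm_ge0 andbT.
apply/predual_matnormP => m z z1; apply: opnorm_le => v v1.
rewrite (_ : \mxblock_(k, l) _ = 0) ?mul0mx ?l2norm0 //.
by apply/matrixP => k l; rewrite !mxE linearB /= xy subrr.
Qed.

Lemma pairing_surj (f : D -> R[i]^o) (K : R) :
  linear f -> 0 <= K -> (forall psi, normc (f psi) <= K * nrm psi) ->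
  exists x, pairing D x = f.
Proof.
move=> flin K0 fK.
pose fL : {linear D -> R[i]^o} := HB.pack f (GRing.isLinear.Build _ _ _ _ f flin).
have fc : continuous fL by apply/continuous_functionalP; exists K.
have : range (pairing D) f by rewrite (pairing_range D).
by move=> [x _ <-]; exists x.
Qed.

End Duality.

(** * Averaging in dual operator spaces *)

Section DualProjection.
Context {R : realType} {S : semigroupType} {X : operatorSpaceType R}.
Variable alpha : S -> {linear X -> X}.
Hypothesis alphaS : operator_S_space alpha.

(** [T] is kept abstract to serve both all bounded functions and the left uniformly continuous ones;
    the coefficients of the action have to lie in it. *)
Lemma dual_projection (D : dual_operator_S_space alpha) (T : set (S -> R[i])) mu :
  unital_subspace T -> mean_on T mu ->
  (forall t f, T f -> mu (ltrans t f) = mu f) ->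
  (forall x psi, T (fun s => pairing D (alpha s x) psi)) ->
  has_projection alpha.
Proof.
move=> TT mm mI TD.
have [C [C0 EC aC]] := action_bound alphaS (mean_nonempty TT mm).
have aN := action_nrm aC.
pose L x psi : R[i]^o := mu (fun s => pairing D (alpha s x) psi).
have Llin x : linear (L x).
  move=> c u v; rewrite -[RHS]/(c * L x u + L x v) /L.
  case: (mm) => mL _ _; rewrite -mL //; congr mu; apply/funext => s.
  exact: pairing_linear.
have Lb x psi : normc (L x psi) <= C * nrm x * nrm psi.
  case: (mm) => _ mb _; apply: mb => // s.
  by apply: le_trans (pairing_bound _ _) _; rewrite ler_wpM2r ?nrm_ge0.
have exP x : exists y, pairing D y = L x.
  by apply: (pairing_surj (Llin x) _ (Lb x)); rewrite mulr_ge0 ?nrm_ge0.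
pose P x := sval (cid (exP x)).
have PE x psi : pairing D (P x) psi = mu (fun s => pairing D (alpha s x) psi).
  by rewrite /P (svalP (cid (exP x))).
have Plin : linear P.
  move=> c u v; apply: (@pairing_inj _ _ D); apply/funext => psi.
  rewrite PE linearP /= -[RHS]/(c * pairing D (P u) psi + pairing D (P v) psi) !PE.
  case: (mm) => mL _ _; rewrite -mL //; congr mu; apply/funext => s.
  by rewrite !linearP.
pose PL : {linear X -> X} := HB.pack P (GRing.isLinear.Build _ _ _ _ P Plin).
apply: (@projectionI _ _ _ alpha PL C EC) => [n x x1|t x|x xfix].
- apply/predual_matnormP => m y y1; apply: opnorm_le => v v1.
  (* Multiplying by [v] commutes with the mean: the block matrix of [P x] sends [v] to the
     coordinatewise mean of the vectors [W s], each of $\ell^2$ norm at most [C]. *)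
  pose W s := (\mxblock_(k < m, l < m)
    map_mx (pairing_mx (D := D) (map_mx (alpha s) x)) y k l) *m v.
  have WE s i : W s i 0 = \sum_j v j 0 *
      pairing D (alpha s (x (tagnat.sig2 i) (tagnat.sig2 j))) (y (tagnat.sig1 i) (tagnat.sig1 j)).
    rewrite mxE; apply: eq_bigr => j _; rewrite mulrC; congr (_ * _).
    by rewrite !mxE.
  have -> : (\mxblock_(k < m, l < m) map_mx (pairing_mx (D := D) (map_mx PL x)) y k l) *m v
      = \col_i mu (fun s => W s i 0).
    apply/matrixP => i j; rewrite (ord1 j) [RHS]mxE.
    rewrite (funext (fun s => WE s i)).
    rewrite (mean_sum TT mm) => [|k]; last exact: subspaceZ.
    rewrite mxE; apply: eq_bigr => k _; rewrite (meanZ TT mm) // mulrC.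
    by congr (_ * _); rewrite !mxE PE.
  apply: (mean_l2norm TT mm) => [i|s].
    by rewrite (funext (fun s => WE s i)); apply: subspace_sum => // j; exact: subspaceZ.
  apply: le_trans (le_opnorm _ v1) _.
  have [+ _] := predual_matnormP D (map_mx (alpha s) x) C; apply => //.
  by apply: le_trans (aC _ _ _) _; rewrite ler_piMr.
- apply: (@pairing_inj _ _ D); apply/funext => psi.
  (* [alpha t] passes inside the mean because its adjoint preserves the predual: [preact D t psi] is
     again a test vector. *)
  rewrite -preactE !PE -[RHS](mI t) //; congr mu; apply/funext => s.
  by rewrite /ltrans preactE; case: alphaS => -> _ _.
- apply: (@pairing_inj _ _ D); apply/funext => psi; rewrite PE.
  by under eq_fun do rewrite xfix; exact: (mean_const TT mm).
Qed.

End DualProjection.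

(** * Left uniformly continuous coefficients *)

Section RealModuliOfContinuity.
Context {R : realType}.

Lemma gt0_complexP (e : R[i]) : 0 < e -> exists2 d : R, 0 < d & e = d%:C.
Proof.
move=> e0; have /complex_realP[d de] := gtr0_real e0.
by exists d; rewrite // -ltcR -de.
Qed.

Lemma norm_scalar_le (z : R[i]^o) (e : R) : (`|z| <= e%:C) = (normc z <= e).
Proof. by rewrite [X in X <= _]normcRE lecR. Qed.

Lemma norm_scalar_lt (z : R[i]^o) (e : R) : (`|z| < e%:C) = (normc z < e).
Proof. by rewrite [X in X < _]normcRE ltcR. Qed.

Lemma cvg_scalarP (T : topologicalType) (f : T -> R[i]^o) (t : T) :
  {for t, continuous f} <-> forall e : R, 0 < e -> \forall u \near t, normc (f u - f t) <= e.
Proof.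
split=> [/cvgrPdist_le h e e0|h].
  have := h e%:C; rewrite ltcR => /(_ e0); apply: filterS => u.
  by rewrite distrC norm_scalar_le.
apply/(@cvgrPdist_le _ _ _ (nbhs t)) => _ /gt0_complexP[e e0 ->].
by apply: filterS (h e e0) => u; rewrite distrC norm_scalar_le.
Qed.

Lemma cvg_nrmP (T : topologicalType) (X : operatorSpaceType R) (f : T -> X) (t : T) :
  {for t, continuous f} <-> forall e : R, 0 < e -> \forall u \near t, nrm (f u - f t) <= e.
Proof.
split=> [/cvgrPdist_le h e e0|h].
  have := h e%:C; rewrite ltcR => /(_ e0); apply: filterS => u.
  by rewrite distrC normE lecR.
apply/(@cvgrPdist_le _ _ _ (nbhs t)) => _ /gt0_complexP[e e0 ->].
by apply: filterS (h e e0) => u; rewrite distrC normE lecR.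
Qed.

End RealModuliOfContinuity.

Section LeftUniformContinuity.
Context {R : realType} {S : preTopologicalSemigroupType}.

Lemma left_uniformly_continuousP (f : S -> R[i]) :
  left_uniformly_continuous_functions f <->
  [/\ bounded_functions f,
    forall t (e : R), 0 < e -> \forall u \near t, normc (f u - f t) <= e &
    forall s (e : R), 0 < e ->
      \forall u \near s, forall t, normc (f (u * t)%g - f (s * t)%g) <= e].
Proof.
split=> -[bf cf uf]; split=> //.
- by move=> t; apply/(cvg_scalarP (f : S -> R[i]^o)); exact: cf.
- move=> s e e0.
  pose P := [set h : S -> R[i] | forall t, normc (h t - f (s * t)%g) <= e].
  have : nbhs (ltrans s f : {uniform S -> R[i]^o}) P.
    apply/uniform_nbhs; exists [set xy : R[i]^o * R[i]^o | ball xy.1 e%:C xy.2].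
    split; first by rewrite -entourage_ballE; exists e%:C => //=; rewrite ltcR.
    move=> h hP t; have := hP t I; rewrite /= -ball_normE /= /ltrans distrC.
    by rewrite norm_scalar_lt => /ltW.
  by move=> /uf.
- by move=> t; apply/(cvg_scalarP (f : S -> R[i]^o)); exact: cf.
- move=> s P /uniform_nbhs [E [+ EP]].
  rewrite -entourage_from_ballE => -[_ /gt0_complexP[e e0 ->] bE].
  have e2 : 0 < e / 2 by rewrite divr_gt0.
  apply: filterS (uf s _ e2) => u hu; apply: EP => t _; apply: bE => /=.
  rewrite -ball_normE /= distrC norm_scalar_lt; apply: le_lt_trans (hu t) _.
  by rewrite ltr_pdivrMr // mulr_natr mulr2n ltrDl.
Qed.

Lemma unital_left_uniformly_continuous :
  unital_subspace (@left_uniformly_continuous_functions R S).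
Proof.
split.
  apply/left_uniformly_continuousP; split.
  - exact: (unital_bounded R S).1.
  - by move=> t e e0; apply: nearW => u; rewrite subrr Normc.normc0 ltW.
  - by move=> s e e0; apply: nearW => u t; rewrite subrr Normc.normc0 ltW.
move=> c f g /left_uniformly_continuousP[bf cf uf] /left_uniformly_continuousP[bg cg ug].
have key (e : R) : 0 < e -> exists2 d : R, 0 < d & forall x x' y y' : R[i],
    normc (x - x') <= d -> normc (y - y') <= d ->
    normc ((c * x + y) - (c * x' + y')) <= e.
  move=> e0; pose K := normc c + 1.
  have K0 : 0 < K by rewrite ltr_wpDl ?normc_ge0.
  exists (e / K); first by rewrite divr_gt0.
  move=> x x' y y' hx hy.
  have -> : c * x + y - (c * x' + y') = c * (x - x') + (y - y') by ring.
  apply: le_trans (normcD _ _) _; rewrite Normc.normcM.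
  apply: (@le_trans _ _ (normc c * (e / K) + e / K)).
    by rewrite lerD // ler_wpM2l ?normc_ge0.
  by rewrite -[X in _ + X]mul1r -mulrDl mulrC divfK // gt_eqF.
apply/left_uniformly_continuousP; split.
- exact: (unital_bounded R S).2.
- move=> t e /key[d d0 hd]; near=> u; apply: hd; near: u; [exact: cf|exact: cg].
- move=> s e /key[d d0 hd]; near=> u => t; apply: hd; move: t; near: u; [exact: uf|exact: ug].
Unshelve. all: by end_near. Qed.

Variables (X : operatorSpaceType R) (alpha : S -> {linear X -> X}).
Hypothesis alphaS : operator_S_space alpha.

(** The hypothesis expresses norm continuity of the predual orbits through the pairing. Applied to
    the vectors [alpha t x], all of norm at most [C * nrm x], it bounds the variation of a
    coefficient uniformly in [t], as left uniform continuity demands. *)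
Lemma topological_dual_projection (D : dual_operator_S_space alpha) :
  amenable_topological_group R S ->
  (forall (psi : D) s (e : R), 0 < e -> \forall u \near s, forall x,
    normc (pairing D (alpha u x) psi - pairing D (alpha s x) psi) <= e * nrm x) ->
  has_projection alpha.
Proof.
move=> [[e0 _] amS] hc.
have LU := unital_left_uniformly_continuous.
have [mu mm mI] := amenable_mean LU amS.
apply: (dual_projection alphaS (D := D) LU mm mI) => x psi.
have [C [C0 _ aC]] := action_bound alphaS (ex_intro _ e0 I).
have aN := action_nrm aC.
have scale (r : R) : 0 < r -> exists2 d : R, 0 < d & forall y : X, nrm y <= C * nrm x ->
    d * nrm y <= r.
  move=> r0; pose K := C * nrm x + 1.
  have K0 : 0 < K by rewrite ltr_wpDl ?mulr_ge0 ?nrm_ge0.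
  exists (r / K) => [|y yK]; first by rewrite divr_gt0.
  rewrite mulrAC ler_pdivrMr // ler_wpM2l ?(ltW r0) //.
  by apply: le_trans yK _; rewrite lerDl.
apply/left_uniformly_continuousP; split.
- exists (C * nrm x * nrm psi) => s; apply: le_trans (pairing_bound _ _) _.
  by rewrite ler_wpM2r ?nrm_ge0.
- move=> t r r0; have d0 : 0 < r / (nrm x + 1) by rewrite divr_gt0 // ltr_wpDl ?nrm_ge0.
  apply: filterS (hc psi t _ d0) => u /(_ x) h; apply: le_trans h _.
  by rewrite mulrAC ler_pdivrMr ?ltr_wpDl ?nrm_ge0 // ler_wpM2l ?(ltW r0) // lerDl.
- move=> s r /scale[d d0 hd]; apply: filterS (hc psi s _ d0) => u h t.
  case: alphaS => aM _ _; rewrite !aM; apply: le_trans (h _) _.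
  exact/hd/aN.
Qed.

Lemma strongly_continuous_dual_projection (D : dual_operator_S_space alpha) :
  amenable_topological_group R S ->
  (forall psi : D, continuous (fun s => preact D s psi)) ->
  has_projection alpha.
Proof.
move=> amS hc; apply: (topological_dual_projection amS (D := D)) => psi s e e0.
have /cvg_nrmP/(_ e e0) := hc psi s; apply: filterS => u h x.
rewrite -!preactE.
have -> : pairing D x (preact D u psi) - pairing D x (preact D s psi)
    = pairing D x (preact D u psi - preact D s psi).
  have := pairing_linear x (-1) (preact D s psi) (preact D u psi).
  by rewrite !scaleN1r => e1; rewrite addrC [preact D u psi - _]addrC; exact: esym e1.
apply: le_trans (pairing_bound _ _) _.
by rewrite mulrC ler_wpM2r ?nrm_ge0.
Qed.

End LeftUniformContinuity.

(** * Weakly continuous orbits in topological groups *)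

Lemma compact_seq_cluster (T : topologicalType) (A : set T) (t : nat -> T) :
  compact A -> (forall n, A (t n)) -> exists2 p, A p &
    forall U, nbhs p U -> forall N, exists2 n, (N <= n)%N & U (t n).
Proof.
move=> cA tA; have [p [Ap cp]] : A `&` cluster (t @ \oo) !=set0.
  by apply: cA; exists 0%N => // n _; exact: tA.
exists p => // U Up N.
have : (t @ \oo) [set t n | n in [set n | (N <= n)%N]].
  by exists N => // n /= Nn; exists n.
by move=> /cp/(_ Up)[_ [[n Nn <-] Un]]; exists n.
Qed.

Lemma separated_sequence (T : eqType) (R : realType) (A : set T) (d : T -> T -> R) (e : R) :
  (forall l : seq T, exists2 a, A a & forall b, b \in l -> e < d a b) ->
  exists t : nat -> T, forall n, A (t n) /\ forall m, (m < n)%N -> e < d (t n) (t m).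
Proof.
move=> h.
pose g l := sval (cid2 (h l)).
have gA l : A (g l) by rewrite /g; case: cid2.
have gd l b : b \in l -> e < d (g l) b by rewrite /g; case: cid2 => /= a _; exact.
pose L := fix L n := if n is m.+1 then g (L m) :: L m else [::].
exists (fun n => g (L n)) => n; split=> // m mn; apply: gd.
elim: n mn => [//|n IH]; rewrite ltnS leq_eqVlt inE => /orP[/eqP ->|/IH ->].
  by rewrite eqxx.
by rewrite orbT.
Qed.

Section Seminorm.
Context {R : realType} (V : lmodType R[i]).

Definition seminorm (N : V -> R) := (forall u v, N (u + v) <= N u + N v) /\
  forall (c : R[i]) u, N (c *: u) = normc c * N u.

Lemma seminormI (N : V -> R) : (forall u v, N (u + v) <= N u + N v) ->
  (forall (c : R[i]) u, N (c *: u) <= normc c * N u) -> (forall u, 0 <= N u) ->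
  seminorm N.
Proof.
move=> ND NZ N0; split=> // c u; apply/eqP; rewrite eq_le NZ /=.
have [->|c0] := eqVneq c 0; first by rewrite Normc.normc0 mul0r N0.
have n0 : 0 < normc c.
  by rewrite lt_def normc_ge0 andbT; apply: contra c0 => /eqP/Normc.eq0_normc ->.
have := NZ c^-1 (c *: u); rewrite scalerA mulVf // scale1r Normc.normcV.
by rewrite mulrC ler_pdivlMr // mulrC.
Qed.

Variables (N : V -> R) (sN : seminorm N).

Lemma seminorm0 : N 0 = 0.
Proof. by rewrite -(scale0r 0) sN.2 Normc.normc0 mul0r. Qed.

Lemma seminormN u : N (- u) = N u.
Proof. by rewrite -scaleN1r sN.2 normcN Normc.normc1 mul1r. Qed.

Lemma seminorm_ge0 u : 0 <= N u.
Proof. have := sN.1 u (- u); rewrite subrr seminorm0 seminormN; lra. Qed.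

Lemma seminormB u v : N (u - v) = N (v - u).
Proof. by rewrite -seminormN opprB. Qed.

Lemma seminorm_triangle v u w : N (u - w) <= N (u - v) + N (v - w).
Proof. by apply: le_trans (sN.1 _ _); rewrite addrA subrK. Qed.

(* Weak continuity only has to be tested on the functionals dominated by the
   seminorm, since those are the ones produced by [hahn_banach]. *)
Definition weakly_continuous_wrt (T : topologicalType) (f : T -> V) :=
  forall phi : {linear V -> R[i]^o}, (forall v, normc (phi v) <= N v) ->
    continuous (phi \o f).

Variables (T : topologicalType) (f : T -> V).
Hypothesis fw : weakly_continuous_wrt f.

(** Weak lower semicontinuity of the seminorm along [f]: a functional norming [f l - d] is nearly as
    large at [f u - d], and [N] dominates it. *)
Lemma ball_weakly_closed d (r : R) l : r < N (f l - d) ->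
  \forall u \near l, r < N (f u - d).
Proof.
move=> rN; have [phi [phiN phil]] := hahn_banach sN.1 sN.2 (f l - d).
pose e := (N (f l - d) - r) / 2.
have e0 : 0 < e by rewrite divr_gt0 // subr_gt0.
have /cvg_scalarP/(_ e e0) : {for l, continuous (phi \o f)} by exact: fw.
apply: filterS => u hu.
have h1 : normc (phi (f l - d)) = N (f l - d).
  by rewrite phil normc_real ger0_norm // seminorm_ge0.
have h2 : normc (phi (f l - d)) <= normc (phi (f u - d)) + normc (phi (f u) - phi (f l)).
  rewrite -linearB; apply: le_trans (normcB _ _).
  by rewrite -linearB; rewrite (_ : f u - d - (f u - f l) = f l - d) // opprB addrC addrA subrK.
have h3 := phiN (f u - d).
rewrite /= in hu; rewrite /e in hu.
move: hu h1 h2 h3; set a := normc _; set b := normc _; set c := normc _; lra.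
Qed.

(** For [u] near [s], [f u] stays more than [e / 2] away from each of the finitely many net points
    that are that far from [f s]. So the net point within [e / 2] of [f u] is also within [e / 2] of
    [f s]. *)
Lemma totally_bounded_continuous (A : set T) s : nbhs s A ->
  (forall e : R, 0 < e -> exists l : seq T, forall a, A a ->
     exists2 b, b \in l & N (f a - f b) <= e) ->
  forall e : R, 0 < e -> \forall u \near s, N (f u - f s) <= e.
Proof.
move=> As tb e e0; have e2 : 0 < e / 2 by rewrite divr_gt0.
have [l lA] := tb _ e2.
have near_l : \forall u \near s, forall b, b \in l ->
    e / 2 < N (f s - f b) -> e / 2 < N (f u - f b).
  elim: l {lA} => [|b l IH]; first exact: nearW.
  have nb : \forall u \near s, e / 2 < N (f s - f b) -> e / 2 < N (f u - f b).
    have [h|h] := boolP (e / 2 < N (f s - f b)); last exact: nearW.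
    by apply: filterS (ball_weakly_closed h) => u.
  by apply: filterS2 IH nb => u h1 h2 c; rewrite inE => /orP[/eqP ->//|]; exact: h1.
apply: filterS2 As near_l => u /lA[b bl ub] /(_ b bl) sb.
have {sb}sb : N (f s - f b) <= e / 2.
  by rewrite leNgt; apply/negP => /sb; rewrite ltNge ub.
apply: le_trans (seminorm_triangle (f b) _ _) _.
by rewrite [X in _ + X]seminormB [leRHS](splitr e) lerD.
Qed.

End Seminorm.

Section TopologicalGroup.
Variables (S : preTopologicalSemigroupType) (e : S) (inv : S -> S).
Hypotheses (mul1 : left_id e *%g) (mulx1 : right_id e *%g).
Hypotheses (mulV : left_inverse e inv *%g) (mulxV : right_inverse e inv *%g).
Hypotheses (mul_cont : continuous (fun p : S * S => (p.1 * p.2)%g)).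
Hypotheses (inv_cont : continuous inv).

Lemma continuous_mul (T : topologicalType) (a b : T -> S) :
  continuous a -> continuous b -> continuous (fun t => (a t * b t)%g).
Proof.
move=> ca cb t U tU; have [[A B] /= [At Bt] AB] := mul_cont (x := (a t, b t)) tU.
have ha : nbhs t (a @^-1` A) by exact: ca.
have hb : nbhs t (b @^-1` B) by exact: cb.
by apply: filterS2 ha hb => u ? ?; exact: (AB (a u, b u)).
Qed.

Lemma group_invK s : inv (inv s) = s.
Proof. by rewrite -[LHS]mulx1 -(mulV s) mulgA mulV mul1. Qed.

Lemma group_mulVK s t : (s * (inv s * t))%g = t.
Proof. by rewrite mulgA mulxV mul1. Qed.

(** If products of [A] and [B] lie in [U] and [l] is in the closure of [A], some [v] in [A] has
    [inv v * l] in [B], whence [l = v * (inv v * l)] is in [U]. *)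
Lemma topological_group_regular (s : S) (U : set S) : nbhs s U ->
  exists2 U', nbhs s U' & closure U' `<=` U.
Proof.
move=> sU.
have : nbhs (s, e) ((fun p : S * S => (p.1 * p.2)%g) @^-1` U).
  by apply: mul_cont; rewrite /= mulx1.
move=> [[A B] /= [As Be] AB]; exists A => // l cl.
have Bl : nbhs l [set v | B (inv v * l)%g].
  have hc : continuous (fun v => (inv v * l)%g).
    by apply: continuous_mul => //; exact: cst_continuous.
  by apply: (hc l); rewrite /= mulV.
have [v [Av Bv]] := cl _ Bl.
by rewrite -(group_mulVK v l); apply: (AB (v, inv v * l)%g).
Qed.

(** Two terms close to the same cluster point [p] have a quotient close to [inv p * p = e]; the
    second is taken of index at least [n.+1]. *)
Lemma cluster_quotient (A : set S) (t : nat -> S) (U : set S) :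
  compact A -> (forall n, A (t n)) -> nbhs e U ->
  exists n m, (n < m)%N /\ U (inv (t n) * t m)%g.
Proof.
move=> cA tA Ue; have [p Ap tp] := compact_seq_cluster cA tA.
have hc : continuous (fun p : S * S => (inv p.1 * p.2)%g).
  apply: continuous_mul; last by move=> x; exact: cvg_snd.
  by move=> x; apply: continuous_comp; [exact: cvg_fst | exact: inv_cont].
have : nbhs (p, p) ((fun p : S * S => (inv p.1 * p.2)%g) @^-1` U).
  by apply: hc; rewrite /= mulV.
move=> [[B C] /= [Bp Cp] BC].
have [n _ Bn] := tp _ Bp 0%N; have [m nm Cm] := tp _ Cp n.+1.
by exists n, m; split => //; apply: (BC (t n, t m)).
Qed.

End TopologicalGroup.

Lemma rat_dense_complex (R : realType) (z : R[i]) (d : R) : 0 < d ->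
  exists q : rat * rat, normc (z - (ratr q.1 +i* ratr q.2)) <= d.
Proof.
case: z => a b d0; have d2 : 0 < d / 2 by rewrite divr_gt0.
have rat_dense (x : R) : exists q : rat, `|x - ratr q| <= d / 2.
  have [|q] := @rat_in_itvoo R (x - d / 2) (x + d / 2); first lra.
  rewrite in_itv /= => /andP[h1 h2]; exists q.
  by rewrite ler_norml; apply/andP; split; lra.
have [q1 h1] := rat_dense a; have [q2 h2] := rat_dense b; exists (q1, q2).
have -> : (a +i* b) - (ratr q1 +i* ratr q2) = (a - ratr q1)%:C + 'i * (b - ratr q2)%:C.
  by simpc.
apply: le_trans (normcD _ _) _; rewrite Normc.normcM !normc_real.
by rewrite [normc 'i]/= expr0n expr1n add0r sqrtr1 mul1r [leRHS](splitr d) lerD.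
Qed.

(* [span_dist] is the distance to the closed linear span of the [g i]. *)
Section RationalSpan.
Context {R : realType} (V : lmodType R[i]) (N : V -> R) (sN : seminorm N).
Variables (I : Type) (g : I -> V).

(** Rational coefficients leave countably many combinations when [I] is countable, so that the Baire
    argument can enumerate them. The price is that complex multiples are only approximated, see
    [ratcomb_scale]. *)
Definition ratcomb (c : seq (rat * rat * I)) : V :=
  \sum_(z <- c) ((ratr z.1.1 +i* ratr z.1.2) *: g z.2).

Definition span_dist (v : V) : R := inf [set N (v - ratcomb c) | c in [set: seq (rat * rat * I)]].

Let has_inf_dist v : has_inf [set N (v - ratcomb c) | c in [set: seq (rat * rat * I)]].
Proof.
split; first by exists (N (v - ratcomb [::])); exists [::].
by exists 0 => _ [c _ <-]; exact: seminorm_ge0.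
Qed.

Lemma span_dist_le v c : span_dist v <= N (v - ratcomb c).
Proof. by apply: ge_inf; [case: (has_inf_dist v) | exists c]. Qed.

Lemma span_dist_lt v (r : R) : span_dist v < r -> exists c, N (v - ratcomb c) < r.
Proof.
move=> vr; have r0 : 0 < r - span_dist v by rewrite subr_gt0.
have [_ [c _ <-]] := inf_adherent r0 (has_inf_dist v).
by rewrite -/(span_dist v) subrKC => h; exists c.
Qed.

Lemma span_dist_ge0 v : 0 <= span_dist v.
Proof.
apply: lb_le_inf; first by case: (has_inf_dist v).
by move=> _ [c _ <-]; exact: seminorm_ge0.
Qed.

Lemma span_dist_le_seminorm v : span_dist v <= N v.
Proof. by apply: le_trans (span_dist_le v [::]) _; rewrite /ratcomb big_nil subr0. Qed.

Lemma ratcomb_scale (c : R[i]) d (r : R) : 0 < r ->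
  exists d', N (c *: ratcomb d - ratcomb d') <= r.
Proof.
elim: d r => [|z d IH] r r0.
  by exists [::]; rewrite /ratcomb !big_nil scaler0 subrr (seminorm0 sN) ltW.
have r2 : 0 < r / 2 by rewrite divr_gt0.
have [d' hd] := IH _ r2.
pose w : R[i] := c * (ratr z.1.1 +i* ratr z.1.2).
have q0 : 0 < r / 2 / (N (g z.2) + 1) by rewrite divr_gt0 // ltr_wpDl // seminorm_ge0.
have [q hq] := rat_dense_complex w q0.
exists ((q.1, q.2, z.2) :: d'); rewrite /ratcomb !big_cons -!/(ratcomb _) /=.
have -> : c *: ((ratr z.1.1 +i* ratr z.1.2) *: g z.2 + ratcomb d)
    - ((ratr q.1 +i* ratr q.2) *: g z.2 + ratcomb d')
  = (w - (ratr q.1 +i* ratr q.2)) *: g z.2 + (c *: ratcomb d - ratcomb d').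
  by rewrite scalerDr scalerA scalerBl opprD addrACA.
apply: le_trans (sN.1 _ _) _; rewrite sN.2 [leRHS](splitr r) lerD //.
apply: le_trans (ler_wpM2r (seminorm_ge0 sN _) hq) _.
rewrite mulrAC ler_pdivrMr ?ltr_wpDl ?seminorm_ge0 // ler_wpM2l ?(ltW r2) //.
by rewrite lerDl.
Qed.

Lemma seminorm_span_dist : seminorm span_dist.
Proof.
have leZ (c : R[i]) u : span_dist (c *: u) <= normc c * span_dist u.
  apply/ler_addgt0Pr => e e0; pose K := normc c + 1.
  have K0 : 0 < K by rewrite ltr_wpDl ?normc_ge0.
  have eK : 0 < e / K by rewrite divr_gt0.
  have [d hd] : exists d, N (u - ratcomb d) < span_dist u + e / K.
    by apply: span_dist_lt; rewrite ltrDl.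
  have [d' hd'] := ratcomb_scale c d eK.
  apply: le_trans (span_dist_le _ d') _.
  apply: le_trans (seminorm_triangle sN (c *: ratcomb d) _ _) _.
  rewrite -scalerBr sN.2.
  apply: (@le_trans _ _ (normc c * (span_dist u + e / K) + e / K)).
    by rewrite lerD // ler_wpM2l ?normc_ge0 // ltW.
  rewrite mulrDr -addrA lerD2l -[X in _ + X]mul1r -mulrDl.
  by rewrite mulrC divfK // gt_eqF.
apply: seminormI leZ span_dist_ge0 => u v.
apply/ler_addgt0Pr => e e0; have e2 : 0 < e / 2 by rewrite divr_gt0.
have [c hc] : exists c, N (u - ratcomb c) < span_dist u + e / 2.
  by apply: span_dist_lt; rewrite ltrDl.
have [d hd] : exists d, N (v - ratcomb d) < span_dist v + e / 2.
  by apply: span_dist_lt; rewrite ltrDl.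
apply: le_trans (span_dist_le _ (c ++ d)) _.
rewrite /ratcomb big_cat /= -!/(ratcomb _) opprD addrACA.
apply: le_trans (sN.1 _ _) _; lra.
Qed.

Lemma span_dist_generator i : span_dist (g i) = 0.
Proof.
apply/eqP; rewrite eq_le span_dist_ge0 andbT.
apply: le_trans (span_dist_le _ [:: (1%:Q, 0%:Q, i)]) _.
rewrite /ratcomb big_seq1 /= rmorph1 rmorph0.
by rewrite (_ : 1 +i* 0 = 1 :> R[i]) // scale1r subrr (seminorm0 sN).
Qed.

End RationalSpan.

Section WeaklyContinuousOrbits.
Context {R : realType} {S : preTopologicalSemigroupType} (V : lmodType R[i]).
Variables (N : V -> R) (act : S -> V -> V) (M : R) (x : V).
Hypotheses (Sgroup : topological_group S) (sN : seminorm N) (M0 : 0 <= M).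
Hypothesis act_mul : forall s t v, act (s * t)%g v = act s (act t v).
Hypothesis actN : forall s u v, N (act s u - act s v) <= M * N (u - v).
Hypothesis act_weak : weakly_continuous_wrt N (fun s => act s x).

(* If the orbit had an infinite [r]-separated sequence [act (t n) x] with [t n]
   in a compact set, the countable set [H] generated by the quotients
   [(t i)^-1 t j] would have a norm separable orbit.  By the Baire category
   argument on the closure of [H], the orbit of [H] has small oscillation near
   some [h] in [H]; but [h ((t n)^-1 t m)] is close to [h] for some [n < m]. *)
Lemma weakly_continuous_orbit_totally_bounded (s0 : S) (K A : set S) :
  compact K -> nbhs s0 K -> compact A -> forall r : R, 0 < r ->
  exists l : seq S, forall a, A a -> exists2 b, b \in l &
    N (act a x - act b x) <= r.
Proof.
move=> cK Ks0 cA r r0; apply: contrapT => ntb.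
have [t tP] : exists t : nat -> S, forall n, A (t n) /\
    forall m, (m < n)%N -> r < N (act (t n) x - act (t m) x).
  apply: (@separated_sequence S R A (fun a b => N (act a x - act b x))) => l.
  apply: contrapT => h; apply: ntb; exists l => a Aa; apply: contrapT => h'.
  apply: h; exists a => // b bl; rewrite ltNge; apply/negP => hb.
  by apply: h'; exists b.
have [e [inv [[mul1 mulx1] [mulV mulxV] mul_cont inv_cont]]] := Sgroup.
pose f s := act s x.
(* [H] is reached from [s0] by right multiplication with quotients; coding its elements by words in
   pairs of indices makes it countable. *)
pose hval := fix hval (w : seq (nat * nat)) : S :=
  if w is ij :: w' then (hval w' * (inv (t ij.1) * t ij.2))%g else s0.
pose D := seq (rat * rat * seq (nat * nat)).
pose dval : D -> V := ratcomb (f \o hval).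
pose p := span_dist N (f \o hval).
have sp : seminorm p by exact: seminorm_span_dist.
(* Two errors [d], magnified by [M], do not exceed [r]. *)
pose d := r / (2 * (M + 1)).
have M1 : 0 < M + 1 by rewrite ltr_wpDl.
have d0 : 0 < d by rewrite divr_gt0 // mulr_gt0.
(* A functional norming [f l] for [p] kills the orbit of [H]; being continuous along [f], it also
   kills [f l] when [l] is in the closure. *)
have closure_H l : closure (range hval) l -> p (f l) = 0.
  move=> Hl; have [phi [phip phil]] := hahn_banach sp.1 sp.2 (f l).
  have phiN v : normc (phi v) <= N v.
    by apply: le_trans (phip v) _; exact: span_dist_le_seminorm.
  apply/eqP; rewrite eq_le (seminorm_ge0 sp) andbT.
  apply/ler_addgt0Pr => e1 e10; rewrite add0r.
  have /cvg_scalarP/(_ e1 e10)/Hl[_ [[w _ <-] /= hw]] :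
    {for l, continuous (phi \o f)} by exact: act_weak.
  have phiw : phi (f (hval w)) = 0.
    apply: Normc.eq0_normc; apply/eqP; rewrite eq_le normc_ge0 andbT.
    by apply: le_trans (phip _) _; rewrite /p (span_dist_generator sN (f \o hval) w).
  move: hw; rewrite /f in phiw phil *; rewrite phiw phil sub0r normcN normc_real.
  by apply: le_trans; exact: ler_norm.
(* Baire argument: otherwise there are decreasing neighbourhoods of points of [H], starting from
   [K], whose closures avoid in turn the [d]-ball around each [dval (c n)]. A cluster point [l] of
   these points lies in all the closures and in the closure of [H], so [f l] has distance [0] from
   the combinations, a contradiction. *)
have [c [w [U [Uw HU]]]] : exists (c : D) w U, nbhs (hval w) U /\
    forall w', U (hval w') -> N (f (hval w') - dval c) <= d.
  apply: contrapT => no_small.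
  (* Numbers that code no element of [D] stand for the empty combination. *)
  pose c n : D := odflt [::] (unpickle n).
  pose good (hU : S * set S) := range hval hU.1 /\ nbhs hU.1 hU.2.
  have step n hU : exists hU', good hU -> [/\ good hU', closure hU'.2 `<=` hU.2 &
      forall u, closure hU'.2 u -> d < N (f u - dval (c n))].
    have [[[w _ hw] hn]|ng] := pselect (good hU); last by exists hU.
    have hni : nbhs (hval w) (interior hU.2) by rewrite hw; exact: nbhs_interior.
    have [w' Iw' dw'] : exists2 w', interior hU.2 (hval w') &
        d < N (f (hval w') - dval (c n)).
      apply: contrapT => h; apply: no_small; exists (c n), w, (interior hU.2).
      split=> // w' Iw'; rewrite leNgt; apply/negP => hd; apply: h.
      by exists w'.
    have fw : nbhs (hval w') (hU.2 `&` [set u | d < N (f u - dval (c n))]).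
      by apply: filterI => //; exact: (ball_weakly_closed sN act_weak).
    have [U' U'w clU'] := topological_group_regular mul1 mulx1 mulV mulxV mul_cont inv_cont fw.
    exists (hval w', U') => _; split=> [|u /clU'[]//|u /clU'[]//].
    by split => //=; exists w'.
  pose g n hU := sval (cid (step n hU)).
  pose q := fix q n := if n is m.+1 then g m (q m) else (s0, K).
  have gq n : good (q n).
    elim: n => [|n IH]; first by split=> //; exists [::].
    by rewrite /= /g; case: cid => hU' /= /(_ IH)[].
  have qP n : closure (q n.+1).2 `<=` (q n).2 /\
      forall u, closure (q n.+1).2 u -> d < N (f u - dval (c n)).
    by rewrite [q n.+1]/= /g; case: cid => hU' /= /(_ (gq n))[].
  have qle n m : (n <= m)%N -> (q m).2 `<=` (q n).2.
    move=> /subnK <-; elim: (m - n)%N => [//|k IH].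
    apply: subset_trans IH; rewrite addSn.
    by move=> u hu; apply: (qP _).1; exact: subset_closure.
  have qin n : (q n).2 (q n).1 by apply: nbhs_singleton; case: (gq n).
  have [l _ ql] := compact_seq_cluster (t := fun n => (q n).1) cK
    (fun n => qle 0%N n (leq0n n) _ (qin n)).
  have lH : closure (range hval) l.
    move=> W /ql/(_ 0%N)[n _ Wn]; exists (q n).1; split => //.
    by case: (gq n).
  have lq n : closure (q n).2 l.
    move=> W /ql/(_ n)[m nm Wm]; exists (q m).1; split => //.
    exact: qle nm _ (qin m).
  have [c0 hc0] : exists c0, N (f l - dval c0) < d.
    by apply: (span_dist_lt sN); rewrite -/p closure_H.
  have := (qP (pickle c0)).2 l (lq _).
  by rewrite /c pickleK /= ltNge ltW.
have Ue : nbhs e [set u | U (hval w * u)%g].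
  have hc : continuous (fun u => (hval w * u)%g).
    by apply: continuous_mul => // y; [exact: cvg_cst | exact: cvg_id].
  by apply: (hc e); rewrite /= mulx1.
have [n [m [nm Unm]]] := cluster_quotient mulV mul_cont inv_cont cA (fun n => (tP n).1) Ue.
have h1 := HU ((n, m) :: w) Unm.
have h2 := HU w (nbhs_singleton Uw).
have h3 : N (f (hval ((n, m) :: w)) - f (hval w)) <= d + d.
  apply: le_trans (seminorm_triangle sN (dval c) _ _) _.
  by rewrite lerD // (seminormB sN).
(* Acting by [t n * inv (hval w)] carries the two nearby orbit points to [act (t m) x] and
   [act (t n) x], which are more than [r] apart. *)
have h4 := actN (t n * inv (hval w))%g (f (hval ((n, m) :: w))) (f (hval w)).
rewrite /f -!act_mul /= in h4.
have e1 : ((t n * inv (hval w)) * (hval w * (inv (t n) * t m)) = t m)%g.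
  by rewrite -mulgA [(inv (hval w) * _)%g]mulgA mulV mul1 mulgA mulxV mul1.
have e2 : ((t n * inv (hval w)) * hval w = t n)%g by rewrite -mulgA mulV mulx1.
rewrite e1 e2 in h4.
have := lt_le_trans ((tP m).2 n nm) h4.
rewrite ltNge => /negP; apply.
apply: le_trans (ler_wpM2l M0 h3) _.
rewrite -mulr2n -mulr_natl mulrA /d mulrA ler_pdivrMr ?mulr_gt0 //.
by rewrite mulrC ler_wpM2l ?(ltW r0) // mulrC ler_wpM2l // lerDl.
Qed.

End WeaklyContinuousOrbits.

(** * Weak-star continuous actions of locally compact groups *)

Section PredualSeminorm.
Context {R : realType} {X : operatorSpaceType R} (D : predual X).

(** The norm of [psi] as a functional on [X]; in it, the bound [C] on [alpha] passes to [preact] by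
    duality. *)
Definition predual_seminorm (psi : D) : R :=
  sup [set normc (pairing D x psi) | x in [set x | nrm x <= 1]].

Let has_sup_pairing psi :
  has_sup [set normc (pairing D x psi) | x in [set x | nrm x <= 1]].
Proof.
split; first by exists (normc (pairing D 0 psi)); exists 0 => //=; rewrite nrm0.
exists (nrm psi) => _ [x x1 <-]; apply: le_trans (pairing_bound _ _) _.
by rewrite ler_piMl ?nrm_ge0.
Qed.

Lemma pairing_le_unit x psi : nrm x <= 1 -> normc (pairing D x psi) <= predual_seminorm psi.
Proof. by move=> x1; apply: ub_le_sup; [case: (has_sup_pairing psi) | exists x]. Qed.

Lemma predual_seminorm_le psi (K : R) :
  (forall x, nrm x <= 1 -> normc (pairing D x psi) <= K) -> predual_seminorm psi <= K.
Proof.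
move=> h; apply: ge_sup; first by case: (has_sup_pairing psi).
by move=> _ [x x1 <-]; exact: h.
Qed.

Lemma predual_seminorm_ge0 psi : 0 <= predual_seminorm psi.
Proof. by apply: le_trans (normc_ge0 _) (@pairing_le_unit 0 psi _); rewrite nrm0. Qed.

Lemma predual_seminorm_le_nrm psi : predual_seminorm psi <= nrm psi.
Proof.
apply: predual_seminorm_le => x x1; apply: le_trans (pairing_bound _ _) _.
by rewrite ler_piMl ?nrm_ge0.
Qed.

Lemma pairingD (x : X) psi phi :
  pairing D x (psi + phi) = pairing D x psi + pairing D x phi.
Proof. by have := pairing_linear x 1 psi phi; rewrite !scale1r. Qed.

Lemma pairingB (x : X) psi phi :
  pairing D x (psi - phi) = pairing D x psi - pairing D x phi.
Proof. by rewrite pairingD -scaleN1r pairingZ mulN1r. Qed.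

Lemma seminorm_predual : seminorm predual_seminorm.
Proof.
have leZ c psi : predual_seminorm (c *: psi) <= normc c * predual_seminorm psi.
  apply: predual_seminorm_le => x x1; rewrite pairingZ Normc.normcM.
  by rewrite ler_wpM2l ?normc_ge0 // pairing_le_unit.
apply: seminormI leZ predual_seminorm_ge0 => u v.
apply: predual_seminorm_le => x x1; rewrite pairingD.
by apply: le_trans (normcD _ _) _; rewrite lerD ?pairing_le_unit.
Qed.

Lemma pairing_le_seminorm x psi : normc (pairing D x psi) <= nrm x * predual_seminorm psi.
Proof.
have [x0|x0] := eqVneq (nrm x) 0.
  rewrite (nrm_eq0 x0) -(scale0r 0) linearZ /= [normc _]Normc.normcM.
  by rewrite Normc.normc0 mul0r mulr_ge0 ?nrm_ge0 ?predual_seminorm_ge0.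
have xp : 0 < nrm x by rewrite lt_def x0 nrm_ge0.
pose c := (nrm x)^-1.
have cn : normc c%:C = c by rewrite normc_real gtr0_norm // invr_gt0.
have : nrm (c%:C *: x) <= 1 by rewrite nrmZ cn mulVf.
move=> /(pairing_le_unit psi); rewrite linearZ /= [normc _]Normc.normcM.
by rewrite cn ler_pdivrMl // mulrC.
Qed.

Lemma weak_star_continuous_pairing (T : topologicalType) (g : T -> X) psi :
  weak_star_continuous D g -> continuous (fun t => pairing D (g t) psi : R[i]^o).
Proof.
move=> gc.
have c2 : continuous (@weak_star_eval R X D : initial_topology (@weak_star_eval R X D) -> _).
  exact: initial_continuous.
have c3 : continuous (fun h : prod_topology (fun _ : D => R[i]^o) => h psi).
  exact: proj_continuous.
by move=> t; exact: (continuous_comp (continuous_comp (gc t) (c2 _)) (c3 _)).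
Qed.

End PredualSeminorm.

Lemma locally_compact_nbhs (T : topologicalType) : locally_compact [set: T] ->
  forall t : T, exists2 K, nbhs t K & compact K.
Proof.
move=> lc t; have [K tK [cK _]] := lc t I; exists K => //.
have : nbhs t [set u | [set: T] u -> K u] by exact: tK.
by apply: filterS => u; exact.
Qed.

Section WeakStarContinuousActions.
Context {R : realType} {S : preTopologicalSemigroupType}.
Variables (X : operatorSpaceType R) (alpha : S -> {linear X -> X}).
Hypothesis alphaS : operator_S_space alpha.

(* For a locally compact group, weak continuity of the predual action implies
   strong continuity. *)
Lemma weak_star_continuous_dual_projection (D : dual_operator_S_space alpha) :
  amenable_topological_group R S -> locally_compact [set: S] ->
  (forall x, weak_star_continuous D (fun s => alpha s x)) ->
  has_projection alpha.
Proof.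
move=> amS lcS wc; apply: (topological_dual_projection alphaS amS (D := D)).
move=> psi s r r0; have Sgroup := amS.1.
have [e [inv [[mul1 mulx1] [mulV mulxV] mul_cont inv_cont]]] := Sgroup.
have invinv s' : inv (inv s') = s' := group_invK mul1 mulx1 mulV s'.
have inv_mul s' t : inv (s' * t)%g = (inv t * inv s')%g.
  rewrite -[RHS]mulx1 -(mulxV (s' * t)%g) [RHS]mulgA.
  rewrite (_ : (inv t * inv s' * (s' * t))%g = e) ?mul1 //.
  by rewrite -mulgA [(inv s' * _)%g]mulgA mulV mul1 mulV.
have [C [C0 _ aC]] := action_bound alphaS (ex_intro _ e I).
have aN := action_nrm aC.
pose N := @predual_seminorm R X D.
have sN : seminorm N := seminorm_predual D.
(* [preact] reverses products; composing with [inv] yields a left action. *)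
pose act s (phi : D) : D := preact D (inv s) phi.
have preactM s' t phi : preact D (s' * t)%g phi = preact D t (preact D s' phi).
  (* [X] separates the points of [D]: by surjectivity of the pairing, a Hahn-Banach functional on
     [D] is given by an element of [X]. *)
  have sep (u v : D) : (forall x, pairing D x u = pairing D x v) -> u = v.
    move=> uv; apply/eqP; rewrite -subr_eq0; apply/eqP/nrm_eq0.
    have [f [fle fuv]] := hahn_banach (@nrmD _ D) (@nrmZ _ D) (u - v).
    have [x xf] : exists x, pairing D x = f.
      apply: (@pairing_surj _ _ D f 1) => [|//|w]; first exact: linearP.
      by rewrite mul1r.
    move: fuv; rewrite -xf pairingB uv subrr => /(congr1 (@complex.Re R)) /=.
    by move=> <-.
  by apply: sep => x; rewrite !preactE; case: alphaS => -> _ _.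
have act_mul s' t phi : act (s' * t)%g phi = act s' (act t phi).
  by rewrite /act inv_mul preactM.
have actN s' u v : N (act s' u - act s' v) <= C * N (u - v).
  apply: predual_seminorm_le => x x1; rewrite pairingB !preactE -pairingB.
  apply: le_trans (pairing_le_seminorm _ _) _.
  rewrite ler_wpM2r ?predual_seminorm_ge0 //.
  by apply: le_trans (aN _ _) _; rewrite ler_piMr.
have act_weak : weakly_continuous_wrt N (fun s => act s psi).
  move=> phi phiN.
  have [x xphi] : exists x, pairing D x = phi.
    apply: (@pairing_surj _ _ D phi 1) => [|//|w]; first exact: linearP.
    by rewrite mul1r; apply: le_trans (phiN w) (predual_seminorm_le_nrm _).
  rewrite (_ : phi \o _ = (fun s => pairing D (alpha (inv s) x) psi : R[i]^o)); last first.
    by apply/funext => t /=; rewrite -xphi preactE.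
  have ac : continuous (fun t => pairing D (alpha t x) psi : R[i]^o).
    exact: (weak_star_continuous_pairing (wc x)).
  by move=> t; exact: (continuous_comp (inv_cont t) (ac _)).
have [K eK cK] := locally_compact_nbhs lcS e.
(* Total boundedness is wanted near [inv s], since [preact D u] is [act (inv u)]; the compact
   neighbourhood of [e] hosts the Baire argument. *)
have [A sA cA] := locally_compact_nbhs lcS (inv s).
have tb := weakly_continuous_orbit_totally_bounded Sgroup sN C0 act_mul actN act_weak cK eK cA.
have : \forall u \near s, N (act (inv u) psi - act (inv s) psi) <= r.
  have near_inv := totally_bounded_continuous sN act_weak sA tb r0.
  exact: (inv_cont s _ near_inv).
apply: filterS => u /=; rewrite /act !invinv => h x.
rewrite -!preactE -pairingB; apply: le_trans (pairing_le_seminorm _ _) _.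
by rewrite mulrC ler_wpM2r ?nrm_ge0.
Qed.

End WeakStarContinuousActions.

(** * Barycenters in operator spaces *)

Lemma compact_finite_cover (T : topologicalType) (K : set T) (U : T -> set T) :
  compact K -> (forall x, K x -> nbhs x (U x)) ->
  exists l : seq T, forall x, K x -> exists2 y, y \in l & U y x.
Proof.
move=> /compact_near_coveringP cK KU.
pose F := filter_from [set: seq T] (fun l0 => [set l : seq T | {subset l0 <= l}]).
have FF : Filter F.
  apply: filter_from_filter; first by exists [::].
  move=> a b _ _; exists (a ++ b) => // l abl.
  by split=> z zl; apply: abl; rewrite mem_cat zl ?orbT.
have [x Kx|l0 _ /(_ l0 (fun z => id)) h] := cK _ F (fun l x => exists2 y, y \in l & U y x) FF.
  exists (U x, [set l : seq T | x \in l]) => /=.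
    split; first exact: KU.
    by exists [:: x] => // l; apply; rewrite inE.
  by move=> [y l] /= [Uy xl]; exists x.
by exists l0.
Qed.

Section BoundedFunctionals.
Context {R : realType} {X : operatorSpaceType R}.

Definition bounded_by (phi : {linear X -> R[i]^o}) (K : R) :=
  forall v, normc (phi v) <= K * nrm v.

Lemma norming_functional (u : X) : exists2 phi : {linear X -> R[i]^o},
  bounded_by phi 1 & phi u = (nrm u)%:C.
Proof.
have [phi [phiN phiu]] := hahn_banach (@nrmD _ X) (@nrmZ _ X) u.
by exists phi => // v; rewrite mul1r.
Qed.

Lemma functional_separation (u v : X) :
  (forall phi : {linear X -> R[i]^o}, bounded_by phi 1 -> phi u = phi v) -> u = v.
Proof.
move=> h; have [phi phi1 phiu] := norming_functional (u - v).
apply/eqP; rewrite -subr_eq0; apply/eqP/nrm_eq0.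
by move: phiu; rewrite linearB (h _ phi1) subrr => /(congr1 (@complex.Re R)) /= <-.
Qed.

Lemma bounded_by_scale phi (K : R) (c : R[i]) : bounded_by phi K ->
  exists2 psi : {linear X -> R[i]^o}, bounded_by psi (normc c * K) &
    forall u, psi u = c * phi u.
Proof.
move=> phiK; pose g u : R[i]^o := c * phi u.
have glin : linear g.
  move=> a u v; rewrite /g linearP -[RHS]/(a * (c * phi u) + c * phi v).
  by rewrite -[a *: _]/(a * _); ring.
exists (HB.pack_for {linear X -> R[i]^o} g (GRing.isLinear.Build _ _ _ _ g glin)) => // v.
by rewrite /= /g Normc.normcM -mulrA ler_wpM2l ?normc_ge0.
Qed.

End BoundedFunctionals.

Section Barycenters.
Context {R : realType} {S : choiceType} {X : operatorSpaceType R}.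
Variables (mu : (S -> R[i]) -> R[i]) (F : S -> X) (B : R).
Hypothesis mm : mean_on (@bounded_functions R S) mu.
Hypothesis FB : forall s, nrm (F s) <= B.

Let TT := unital_bounded R S.

Lemma bounded_functional_comp phi (K : R) : 0 <= K -> bounded_by phi K ->
  bounded_functions (fun s => phi (F s) : R[i]).
Proof.
move=> K0 phiK; exists (K * B) => s; apply: le_trans (phiK _) _.
by rewrite ler_wpM2l.
Qed.

(** Approximate barycenters with errors [eps n] form a Cauchy sequence, because a functional norming
    their difference sees both as approximations of one mean; norm completeness of [X] gives the
    limit. *)
Lemma barycenter_limit :
  (forall r : R, 0 < r -> exists y, forall phi : {linear X -> R[i]^o}, bounded_by phi 1 ->
     normc (phi y - mu (fun s => phi (F s))) <= r) ->
  exists y, forall (phi : {linear X -> R[i]^o}) K, bounded_by phi K ->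
     phi y = mu (fun s => phi (F s)).
Proof.
move=> h.
pose eps n : R := n.+1%:R^-1.
have eps0 n : 0 < eps n by rewrite invr_gt0.
pose y n := sval (cid (h (eps n) (eps0 n))).
have yP n := svalP (cid (h (eps n) (eps0 n))) : forall phi, bounded_by phi 1 ->
  normc (phi (y n) - mu (fun s => phi (F s))) <= eps n.
have ycauchy n m : nrm (y n - y m) <= eps n + eps m.
  have [phi phi1 phiu] := norming_functional (y n - y m).
  have := normcB (phi (y n) - mu (fun s => phi (F s))) (phi (y m) - mu (fun s => phi (F s))).
  rewrite (_ : _ - _ = phi (y n - y m)); last by rewrite linearB /=; ring.
  rewrite phiu normc_real ger0_norm ?nrm_ge0 // => hh.
  by apply: le_trans hh _; rewrite lerD ?yP.
have eps_small (r : R) : 0 < r -> exists n0, forall n, (n0 <= n)%N -> eps n <= r.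
  move=> r0; exists (Num.trunc r^-1) => n hn; rewrite /eps invf_ple ?posrE //.
  apply: (@le_trans _ _ (Num.trunc r^-1).+1%:R); last by rewrite ler_nat.
  by apply: ltW; apply: truncnS_gt.
have : cvg (y @ \oo).
  apply/cauchy_cvgP/cauchy_exP => _ /gt0_complexP[r r0 ->].
  have r4 : 0 < r / 4 by rewrite divr_gt0.
  have [n0 hn0] := eps_small _ r4.
  exists (y n0), n0 => // n hn; rewrite /= -ball_normE /= normE ltcR.
  apply: le_lt_trans (ycauchy _ _) _.
  have := hn0 _ (leqnn n0); have := hn0 _ hn; lra.
move=> /cvg_ex[z yz].
have zlim (r : R) : 0 < r -> \forall n \near \oo, nrm (z - y n) <= r.
  move=> r0; have /cvgrPdist_le/(_ r%:C) := yz; rewrite ltcR => /(_ r0).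
  by apply: filterS => n; rewrite normE lecR.
have z1 phi : bounded_by phi 1 -> phi z = mu (fun s => phi (F s)).
  move=> phi1; apply/eqP; rewrite -subr_eq0; apply/eqP/Normc.eq0_normc.
  apply/eqP; rewrite eq_le normc_ge0 andbT; apply/ler_addgt0Pr => r r0; rewrite add0r.
  have r2 : 0 < r / 2 by rewrite divr_gt0.
  have [n0 hn0] := eps_small _ r2.
  near \oo => n.
  have -> : phi z - mu (fun s => phi (F s)) =
      phi (z - y n) + (phi (y n) - mu (fun s => phi (F s))).
    by rewrite linearB /=; ring.
  apply: le_trans (normcD _ _) _; rewrite [leRHS](splitr r) lerD //.
    apply: le_trans (phi1 _) _; rewrite mul1r.
    by near: n; exact: zlim.
  apply: le_trans (yP n phi phi1) _; apply: hn0; near: n; exact: nbhs_infty_ge.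
exists z => phi K phiK.
(* [K] need not be positive; its absolute value plus one is a positive bound for the same
   functional. *)
pose c := (`|K| + 1)^-1.
have K1 : 0 < `|K| + 1 by rewrite ltr_wpDl.
have c0 : 0 < c by rewrite invr_gt0.
have [psi psi1 psiE] := bounded_by_scale c%:C phiK.
have phiK1 : bounded_by phi (`|K| + 1).
  move=> v; apply: le_trans (phiK v) _; rewrite ler_wpM2r ?nrm_ge0 //.
  by rewrite (le_trans (ler_norm K)) // lerDl.
have psi1' : bounded_by psi 1.
  move=> v; rewrite psiE Normc.normcM normc_real gtr0_norm // ler_pdivrMl // mulrA mulr1.
  exact: phiK1.
have := z1 _ psi1'; rewrite psiE; under eq_fun do rewrite psiE.
rewrite (meanZ TT mm); last by apply: (bounded_functional_comp _ phiK1); exact: ltW.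
by apply: mulfI; rewrite -[0]/(0%:C) (inj_eq (@complexI R)) gt_eqF.
Unshelve. all: by end_near. Qed.

Lemma totally_bounded_barycenter :
  (forall r : R, 0 < r -> exists l : seq S, forall s,
     exists2 b, b \in l & nrm (F s - F b) <= r) ->
  exists y, forall (phi : {linear X -> R[i]^o}) K, bounded_by phi K ->
     phi y = mu (fun s => phi (F s)).
Proof.
move=> tb; apply: barycenter_limit => r r0; have [l lP] := tb _ r0.
pose b s := sval (cid2 (lP s)).
have bl s : b s \in undup l by rewrite mem_undup /b; case: cid2.
have bF s : nrm (F s - F (b s)) <= r by rewrite /b; case: cid2.
pose ind z : S -> R[i] := fun s => (b s == z)%:R.
have Tind z : bounded_functions (ind z).
  by exists 1 => s; rewrite /ind; case: eqP => _; rewrite ?Normc.normc1 ?Normc.normc0.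
(* The mean of the simple function [F \o b]; [undup] makes each value of [b] count once. *)
exists (\sum_(z <- undup l) mu (ind z) *: F z) => phi phi1.
have -> : phi (\sum_(z <- undup l) mu (ind z) *: F z) = mu (fun s => phi (F (b s))).
  rewrite linear_sum /=.
  under eq_bigr => z _ do
    rewrite linearZ /= -[_ *: _]/(mu (ind z) * phi (F z)) mulrC -(meanZ TT mm _ (Tind z)).
  rewrite -(mean_sum TT mm) => [|z]; last exact: (subspaceZ TT).
  congr mu; apply/funext => s.
  rewrite (bigD1_seq (b s)) ?undup_uniq //= /ind eqxx mulr1 big1 ?addr0 // => z zb.
  by rewrite eq_sym (negbTE zb) mulr0.
have e : (fun s => (-1) * phi (F s) + phi (F (b s))) = (fun s => phi (F (b s)) - phi (F s)).
  by apply/funext => s; rewrite mulN1r addrC.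
have T1 := bounded_functional_comp ler01 phi1.
have T2 : bounded_functions (fun s => phi (F (b s)) : R[i]).
  by case: T1 => C CP; exists C => s; exact: CP.
case: (mm) => mL mb _.
have := mL (-1) _ _ T1 T2; rewrite e mulN1r addrC => <-.
apply: mb => [|s]; first by rewrite -e; exact: TT.2.
by rewrite -linearB; apply: le_trans (phi1 _) _; rewrite mul1r nrmB.
Qed.

End Barycenters.

(** * Averaging without a predual *)

Section NonDualProjection.
Context {R : realType} {S : semigroupType} {X : operatorSpaceType R}.
Variable alpha : S -> {linear X -> X}.
Hypothesis alphaS : operator_S_space alpha.
Variable mu : (S -> R[i]) -> R[i].
Hypothesis mm : mean_on (@bounded_functions R S) mu.

Let TT := unital_bounded R S.

(** The matrix with single entry [u] is [u] sandwiched between scalar matrix units; hence a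
    functional dominated by the norm of $M_n(X)$ has bounded entries. *)
Lemma matnorm_unit n (i j : 'I_n) : exists2 K : R, 0 <= K &
  forall u : X, matnorm n (\matrix_(k, l) if (k, l) == (i, j) then u else 0) <= K * nrm u.
Proof.
pose a : 'M[R[i]]_(n, 1) := delta_mx i 0; pose b : 'M[R[i]]_(1, n) := delta_mx 0 j.
exists (opnorm a * opnorm b); first by rewrite mulr_ge0 ?opnorm_ge0.
move=> u; rewrite mulrAC; apply: le_trans (matnorm_sandwich _ _ a (const_mx u) b).
rewrite le_eqVlt; apply/orP; left; apply/eqP; congr matnorm.
apply/matrixP => k l; rewrite !mxE !big_ord1 !mxE !eqxx andbT /= xpair_eqE.
by case: (k == i); case: (l == j); rewrite /= ?mulr1 ?mulr0 ?mul0r ?scale1r ?scale0r.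
Qed.

(** For the matrix bound, a norming functional [Phi] of [map_mx PL x] on $M_n(X)$ is split into its
    entries [phi ij]. These are bounded on [X], so the barycenter property applies to each; summed
    up, it makes the norm of [map_mx PL x] the mean of [Phi] over the matrices [map_mx (alpha s) x],
    where [Phi] is at most [C]. *)
Lemma barycenter_projection :
  (forall x, exists y, forall (phi : {linear X -> R[i]^o}) K, bounded_by phi K ->
     phi y = mu (fun s => phi (alpha s x))) ->
  (forall x (phi : {linear X -> R[i]^o}) K t, bounded_by phi K ->
     mu (fun s => phi (alpha (t * s)%g x)) = mu (fun s => phi (alpha s x))) ->
  has_projection alpha.
Proof.
move=> exP mI.
have [C [C0 EC aC]] := action_bound alphaS (mean_nonempty TT mm).
have aN := action_nrm aC.
have Tphi x (phi : {linear X -> R[i]^o}) K : 0 <= K -> bounded_by phi K ->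
    bounded_functions (fun s => phi (alpha s x) : R[i]).
  by move=> K0; exact: (bounded_functional_comp (fun s => aN s x)).
pose P x := sval (cid (exP x)).
have PE x := svalP (cid (exP x)) : forall phi K, bounded_by phi K ->
  phi (P x) = mu (fun s => phi (alpha s x)).
have Plin : linear P.
  move=> c u v; apply: functional_separation => phi phi1.
  rewrite linearP -[RHS]/(c * phi (P u) + phi (P v)) !(PE _ _ _ phi1).
  case: (mm) => mL _ _; rewrite -mL; [|exact: Tphi phi1..].
  by congr mu; apply/funext => s; rewrite !linearP.
pose PL : {linear X -> X} := HB.pack P (GRing.isLinear.Build _ _ _ _ P Plin).
apply: (@projectionI _ _ _ alpha PL C EC) => [n x x1|t x|x xfix].
- pose p (g : {ffun 'I_n * 'I_n -> X}) := matnorm n (\matrix_(i, j) g (i, j)).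
  have pD g h : p (g + h) <= p g + p h.
    rewrite /p; apply: le_trans (matnormD _ _ _).
    rewrite le_eqVlt; apply/orP; left; apply/eqP; congr matnorm.
    by apply/matrixP => i j; rewrite !mxE ffunE.
  have pZ c g : p (c *: g) = normc c * p g.
    by rewrite /p -matnormZ; congr matnorm; apply/matrixP => i j; rewrite !mxE ffunE.
  pose of_mx (y : 'M[X]_n) : {ffun 'I_n * 'I_n -> X} := [ffun ij => y ij.1 ij.2].
  have pof y : p (of_mx y) = matnorm n y.
    by congr matnorm; apply/matrixP => i j; rewrite !mxE ffunE.
  have [Phi [Phip PhiP]] := hahn_banach pD pZ (of_mx (map_mx PL x)).
  pose E (ij : 'I_n * 'I_n) (u : X) : {ffun 'I_n * 'I_n -> X} :=
    [ffun kl => if kl == ij then u else 0].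
  have Elin ij : linear (fun u => Phi (E ij u) : R[i]^o).
    move=> c u v; rewrite -linearP; congr (Phi _); apply/ffunP => kl.
    by rewrite !ffunE; case: eqP => // _; rewrite scaler0 addr0.
  pose phi ij : {linear X -> R[i]^o} :=
    HB.pack (fun u => Phi (E ij u) : R[i]^o) (GRing.isLinear.Build _ _ _ _ _ (Elin ij)).
  have phib ij : exists2 K, 0 <= K & bounded_by (phi ij) K.
    have [K K0 KP] := matnorm_unit ij.1 ij.2; exists K => // u.
    apply: le_trans (Phip _) _; apply: le_trans (KP u).
    rewrite le_eqVlt; apply/orP; left; apply/eqP; congr matnorm.
    by apply/matrixP => i j; rewrite !mxE ffunE -surjective_pairing.
  have PhiE y : Phi (of_mx y) = \sum_ij phi ij (y ij.1 ij.2).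
    rewrite -linear_sum; congr (Phi _); apply/ffunP => kl; rewrite sum_ffunE !ffunE.
    rewrite (bigD1 kl) //= ffunE eqxx big1 ?addr0 // => ij ijkl.
    by rewrite ffunE eq_sym (negbTE ijkl).
  have : Phi (of_mx (map_mx PL x)) = mu (fun s => Phi (of_mx (map_mx (alpha s) x))).
    under [X in mu X]eq_fun do rewrite PhiE.
    rewrite PhiE (mean_sum TT mm) => [|ij]; last first.
      have [K K0 KP] := phib ij; under eq_fun do rewrite mxE.
      exact: (Tphi _ _ _ K0 KP).
    apply: eq_bigr => ij _; rewrite mxE; have [K K0 KP] := phib ij.
    by under [X in mu X]eq_fun do rewrite mxE; rewrite -(PE _ _ _ KP).
  rewrite PhiP pof => /(congr1 (@normc R)); rewrite normc_real ger0_norm ?matnorm_ge0 // => ->.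
  have hb s : normc (Phi (of_mx (map_mx (alpha s) x))) <= C.
    apply: le_trans (Phip _) _; rewrite pof; apply: le_trans (aC _ _ _) _.
    by rewrite ler_piMr.
  by case: (mm) => _ mb _; apply: mb => //; exists C.
- apply: functional_separation => phi phi1.
  have glin : linear (phi \o alpha t : X -> R[i]^o).
    by move=> c u v /=; rewrite !linearP.
  pose g : {linear X -> R[i]^o} :=
    HB.pack (phi \o alpha t : X -> R[i]^o) (GRing.isLinear.Build _ _ _ _ _ glin).
  have gC : bounded_by g C.
    by move=> v; apply: le_trans (phi1 _) _; rewrite mul1r.
  have -> : phi (alpha t (PL x)) = g (P x) by [].
  rewrite (PE _ _ _ gC) (PE _ _ _ phi1) -(mI x phi 1 t phi1); congr mu.
  by apply/funext => s /=; case: alphaS => -> _ _.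
- apply: functional_separation => phi phi1; rewrite [LHS](PE _ _ _ phi1).
  by under eq_fun do rewrite xfix; exact: (mean_const TT mm).
Qed.

End NonDualProjection.

Section CompactNormContinuous.
Context {R : realType} {S : preTopologicalSemigroupType} {X : operatorSpaceType R}.
Variable alpha : S -> {linear X -> X}.
Hypothesis alphaS : operator_S_space alpha.

(** Invariance is asked of the coefficients alone, so as to cover the mean on a compact group, known
    to be invariant on continuous functions only. *)
Lemma totally_bounded_projection (mu : (S -> R[i]) -> R[i]) :
  mean_on (@bounded_functions R S) mu ->
  (forall x (phi : {linear X -> R[i]^o}) K t, bounded_by phi K ->
     mu (fun s => phi (alpha (t * s)%g x)) = mu (fun s => phi (alpha s x))) ->
  (forall x (r : R), 0 < r -> exists l : seq S, forall s, exists2 b, b \in l &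
     nrm (alpha s x - alpha b x) <= r) ->
  has_projection alpha.
Proof.
move=> mm mI tb; apply: (barycenter_projection alphaS mm) => // x.
have [C [C0 EC aC]] := action_bound alphaS (mean_nonempty (unital_bounded R S) mm).
exact: (totally_bounded_barycenter mm (fun s => action_nrm aC s x) (tb x)).
Qed.

Lemma amenable_action_invariant (mu : (S -> R[i]) -> R[i]) :
  mean_on (@bounded_functions R S) mu ->
  (forall t f, bounded_functions f -> mu (ltrans t f) = mu f) ->
  forall x (phi : {linear X -> R[i]^o}) K t, bounded_by phi K ->
     mu (fun s => phi (alpha (t * s)%g x)) = mu (fun s => phi (alpha s x)).
Proof.
move=> mm mI x phi K t phiK.
have [C [C0 EC aC]] := action_bound alphaS (mean_nonempty (unital_bounded R S) mm).
apply: (mI t (fun s => phi (alpha s x))).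
apply: (@bounded_functional_comp _ _ _ _ _ (fun s => action_nrm aC s x) phi `|K|) => // v.
by apply: le_trans (phiK v) _; rewrite ler_wpM2r ?nrm_ge0 // ler_norm.
Qed.

Lemma compact_norm_continuous_projection : compact [set: S] ->
  amenable_semigroup R S -> (forall x, continuous (fun s => alpha s x)) ->
  has_projection alpha.
Proof.
move=> cS amS ac; have [mu mm mI] := amenable_mean (unital_bounded R S) amS.
apply: (totally_bounded_projection mm (amenable_action_invariant mm mI)) => x r r0.
have [|l lP] := @compact_finite_cover S setT
    (fun s => [set u | nrm (alpha u x - alpha s x) <= r]) cS.
  by move=> s _; have /cvg_nrmP/(_ r r0) := ac x s.
by exists l => s; have [b bl sb] := lP s I; exists b.
Qed.

End CompactNormContinuous.

(** * Finitely additive measures *)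

Section FinitelyAdditive.
Context {R : realType} {S : Type} (m : set S -> R).
Hypotheses (m_set0 : m set0 = 0) (m_ge0 : forall A, 0 <= m A) (m_le1 : forall A, m A <= 1).
Hypothesis m_mono : forall A B, A `<=` B -> m A <= m B.
Hypothesis m_modular : forall A B, m (A `|` B) + m (A `&` B) = m A + m B.
Variable A : nat -> set S.

(** Stands in, for finitely additive [m], for positive measure of the upper limit of the [A n]
    inside [B]. *)
Definition recurrent (B : set S) := exists2 d : R, 0 < d &
  forall k, exists2 n, (k <= n)%N & d <= m (B `&` A n).

(* Otherwise the sets [U] with [m (U `&` A n) --> 0] are closed under union and
   contain almost all [B `&` A n]; unions of such sets would have unbounded
   measure. *)
Lemma recurrent_step B k : recurrent B -> exists2 n, (k <= n)%N & recurrent (B `&` A n).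
Proof.
move=> [d d0 dB]; apply: contrapT => nrec.
pose Q (U : set S) := forall r : R, 0 < r ->
  exists k', forall n, (k' <= n)%N -> m (U `&` A n) < r.
have QA n : (k <= n)%N -> Q (B `&` A n).
  move=> kn r r0; apply: contrapT => nk; apply: nrec; exists n => //; exists r => // k'.
  apply: contrapT => h; apply: nk; exists k' => n' kn'; rewrite ltNge; apply/negP => hr.
  by apply: h; exists n'.
have QU U W : Q U -> Q W -> Q (U `|` W).
  move=> QU QW r r0; have r2 : 0 < r / 2 by rewrite divr_gt0.
  have [a ha] := QU _ r2; have [b hb] := QW _ r2; exists (maxn a b) => n.
  rewrite geq_max => /andP[an bn]; rewrite setIUl.
  have := m_modular (U `&` A n) (W `&` A n).
  have := m_ge0 ((U `&` A n) `&` (W `&` A n)).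
  have := ha _ an; have := hb _ bn; lra.
have grow j : exists2 U, Q U & j%:R * (d / 2) <= m U.
  elim: j => [|j [U QUj Uj]].
    by exists set0; [move=> r r0; exists 0%N => n _; rewrite set0I m_set0 | rewrite mul0r].
  have d2 : 0 < d / 2 by rewrite divr_gt0.
  (* A late [A n] overlaps [U] in less than [d / 2], while [B] meets infinitely many of them in at
     least [d]: adjoining such an intersection to [U] gains [d / 2]. *)
  have [a ha] := QUj _ d2; have [n] := dB (maxn a k).
  rewrite geq_max => /andP[an kn] dn; exists (U `|` (B `&` A n)).
    by apply: QU => //; exact: QA.
  have h1 := ha _ an.
  have h2 : m (U `&` (B `&` A n)) <= m (U `&` A n) by apply: m_mono => s [? []].
  have := m_modular U (B `&` A n).
  rewrite -natr1 mulrDl mul1r; lra.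
have [U _] := grow (Num.trunc (d / 2)^-1).+1.
have d2 : 0 < d / 2 by rewrite divr_gt0.
apply/negP; rewrite -ltNge; apply: le_lt_trans (m_le1 U) _.
by rewrite -ltr_pdivrMr // mul1r truncnS_gt.
Qed.

Lemma recurrent_nonempty B : recurrent B -> B !=set0.
Proof.
move=> [d d0 /(_ 0%N)[n _ dn]]; apply/set0P/eqP => B0.
by move: dn; rewrite B0 set0I m_set0 leNgt d0.
Qed.

(** Finite additivity does not give a point lying in infinitely many [A n]. Hence the conclusion
    concerns finite intersections along a subsequence; topological compactness supplies the common
    point where the lemma is applied. *)
Lemma finitely_additive_recurrence (d : R) : 0 < d -> (forall n, d <= m (A n)) ->
  exists k : nat -> nat, (forall j, (j <= k j)%N) /\
    forall j, exists s, forall i, (i <= j)%N -> A (k i) s.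
Proof.
move=> d0 dA.
have step (q : set S * nat) : exists n, recurrent q.1 -> (q.2 <= n)%N /\ recurrent (q.1 `&` A n).
  have [rq|nq] := pselect (recurrent q.1); last by exists 0%N.
  by have [n kn rn] := recurrent_step q.2 rq; exists n.
pose g q := sval (cid (step q)).
pose q := fix q j := if j is i.+1 then (((q i).1 `&` A (g (q i))), (g (q i)).+1)
  else ([set: S], 0%N).
have rq j : recurrent (q j).1.
  elim: j => [|j IH]; first by exists d => // k; exists k => //; rewrite setTI.
  by rewrite /= /g; case: cid => n /= /(_ IH)[].
have qg j : ((q j).2 <= g (q j))%N by rewrite /g; case: cid => n /= /(_ (rq j))[].
have qj j : (j <= (q j).2)%N.
  by elim: j => [//|j IH] /=; rewrite ltnS (leq_trans IH).
exists (fun j => g (q j)); split=> [j|j]; first exact: leq_trans (qj j) (qg j).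
have [s qs] := recurrent_nonempty (rq j.+1); exists s => i ij.
have : (q i.+1).1 s.
  have le a b : (a <= b)%N -> (q b).1 `<=` (q a).1.
    move=> /subnK <-; elim: (b - a)%N => [//|c IH].
    by apply: subset_trans IH; rewrite addSn => u [].
  exact: le qs.
by case.
Qed.

End FinitelyAdditive.

Section MeansAsMeasures.
Context {R : realType} {S : Type} (mu : (S -> R[i]) -> R[i]).
Hypothesis mm : mean_on (@bounded_functions R S) mu.

Let TT := unital_bounded R S.

(** The half-plane is approximated by large discs. If the mean has real part [- r < 0], then [f]
    stays within [sqrt (C^2 + l^2)] of [l], while the mean is at distance at least [l + r] from [l];
    the choice [l = C^2 / r] makes this impossible. *)
Lemma mean_Re_ge0 f : bounded_functions f -> (forall s, 0 <= complex.Re (f s)) ->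
  0 <= complex.Re (mu f).
Proof.
move=> bf f0; rewrite leNgt; apply/negP => neg.
have [C0 fC0] := bf; pose C := `|C0| + 1.
have fC s : normc (f s) <= C.
  by apply: le_trans (fC0 s) _; rewrite /C (le_trans (ler_norm _)) // lerDl.
have Cp : 0 < C by rewrite ltr_wpDl.
pose r := - complex.Re (mu f); have r0 : 0 < r by rewrite oppr_gt0.
pose l := C ^+ 2 / r; have l0 : 0 < l by rewrite divr_gt0 // exprn_gt0.
pose K := Num.sqrt (C ^+ 2 + l ^+ 2).
have bnd s : normc (- l%:C + f s) <= K.
  have := fC s; have := f0 s; case: (f s) => a b /= a0.
  rewrite -[X in _ <= X -> _](ger0_norm (ltW Cp)) -sqrtr_sqr
    ler_psqrt ?nnegrE ?addr_ge0 ?sqr_ge0 //.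
  move=> h; rewrite ler_wsqrtr // oppr0 add0r.
  have : 0 <= l * a by rewrite mulr_ge0 // ltW.
  rewrite sqrrD mulNr -mulr_natl; lra.
case: (mm) => mL mb _.
have T1 := subspace_const TT (- l%:C).
have : normc (mu (fun s => - l%:C + f s)) <= K.
  by apply: mb => //; exact: subspaceD.
rewrite (meanD mm) // (mean_const TT mm) => h.
have {h} : l + r <= K.
  apply: le_trans h; rewrite -normcN; apply: le_trans (Re_le_normc _).
  by rewrite /r; case: (mu f) => a b /=; rewrite opprD opprK.
rewrite -[leLHS]ger0_norm; last by rewrite addr_ge0 // ltW.
rewrite -sqrtr_sqr ler_psqrt ?nnegrE ?addr_ge0 ?sqr_ge0 //.
rewrite sqrrD addrAC [leRHS]addrC -addrA lerD2l.
have -> : l * r = C ^+ 2 by rewrite /l divfK // gt_eqF.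
have := exprn_gt0 2 r0; have := exprn_gt0 2 Cp; rewrite mulr2n.
move=> *; lra.
Qed.

Definition indic_fun (A : set S) : S -> R[i] := fun s => (`[< A s >])%:R.

Definition mean_charge (A : set S) : R := complex.Re (mu (indic_fun A)).

Lemma bounded_indic A : bounded_functions (indic_fun A).
Proof.
by exists 1 => s; rewrite /indic_fun; case: asboolP; rewrite ?Normc.normc1 ?Normc.normc0.
Qed.

Lemma mean_charge_mono A B : A `<=` B -> mean_charge A <= mean_charge B.
Proof.
move=> AB; have := mean_Re_ge0 (TT.2 (-1) _ _ (bounded_indic A) (bounded_indic B)).
case: (mm) => mL _ _; rewrite mL; [|exact: bounded_indic..].
rewrite mulN1r addrC ReD /mean_charge => h; rewrite -subr_ge0.
suff : 0 <= complex.Re (mu (indic_fun B)) + complex.Re (- mu (indic_fun A)).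
  by case: (mu (indic_fun A)).
apply: h => s; rewrite mulN1r /indic_fun.
by case: asboolP => [/AB|] As; case: asboolP => //= _; rewrite ?oppr0 ?addNr ?add0r ?ler01.
Qed.

Lemma mean_charge_set0 : mean_charge set0 = 0.
Proof.
rewrite /mean_charge (_ : indic_fun set0 = cst 0) ?(mean0 TT mm) //.
by apply/funext => s; rewrite /indic_fun; case: asboolP.
Qed.

Lemma mean_charge_ge0 A : 0 <= mean_charge A.
Proof. by rewrite -mean_charge_set0 mean_charge_mono. Qed.

Lemma mean_charge_le1 A : mean_charge A <= 1.
Proof.
apply: le_trans (mean_charge_mono (@subsetT _ A)) _.
rewrite /mean_charge (_ : indic_fun setT = cst 1); first by case: (mm) => _ _ ->.
by apply/funext => s; rewrite /indic_fun; case: asboolP => // -[].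
Qed.

Lemma mean_charge_modular A B :
  mean_charge (A `|` B) + mean_charge (A `&` B) = mean_charge A + mean_charge B.
Proof.
rewrite /mean_charge -!ReD -!(meanD mm); try exact: bounded_indic.
congr (complex.Re (mu _)); apply/funext => s; rewrite /indic_fun asbool_or asbool_and.
by case: asboolP; case: asboolP => _ _ /=; rewrite ?addr0 ?add0r.
Qed.

Lemma mean_le_charge A g (K : R) : bounded_functions g ->
  (forall s, normc (g s) <= K) -> (forall s, ~ A s -> g s = 0) ->
  normc (mu g) <= K * mean_charge A.
Proof.
move=> bg gK gA; have [c c1 cmu] := unimodular (mu g).
have T1 := subspaceZ TT (- c) bg.
have := mean_Re_ge0 (TT.2 K%:C _ _ (bounded_indic A) T1).
case: (mm) => mL _ _; rewrite mL //; last exact: bounded_indic.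
rewrite (meanZ TT mm) // mulNr cmu => h.
have e (z : R[i]) (x : R) : complex.Re (K%:C * z - x%:C) = K * complex.Re z - x.
  by case: z => a b /=; rewrite !mul0r subr0.
rewrite -subr_ge0 /mean_charge -e; apply: h => s.
rewrite /indic_fun; case: asboolP => As.
  have h1 : complex.Re (c * g s) <= K.
    by apply: le_trans (Re_le_normc _) _; rewrite Normc.normcM c1 mul1r.
  rewrite mulr1 mulNr ReD; move: h1; case: (c * g s) => a b /= h1.
  by rewrite subr_ge0.
by rewrite mulr0 gA // mulr0 addr0.
Qed.

End MeansAsMeasures.

(** * Separable spaces *)

Section HellyAlternative.
Context {R : realType} {S : choiceType} {X : operatorSpaceType R}.
Variables (mu : (S -> R[i]) -> R[i]) (F : S -> X) (B : R).
Hypothesis mm : mean_on (@bounded_functions R S) mu.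
Hypothesis FB : forall s, nrm (F s) <= B.

Let TT := unital_bounded R S.
Let L (phi : {linear X -> R[i]^o}) : R[i] := mu (fun s => phi (F s)).

(* The first alternative is read off a norming functional of the seminorm
   [dist] below on scalar families indexed by [option 'I_n]. *)
Lemma helly_alternative (c0 K : R) n (x : 'I_n -> X) : 0 < c0 -> 0 < K ->
  (exists v, forall phi, bounded_by phi 1 -> normc (phi v - L phi) <= 2 * c0) \/
  (exists phi, [/\ bounded_by phi (2 * c0)^-1, 2^-1 <= normc (L phi) &
     forall i, normc (phi (x i)) <= K^-1]).
Proof.
move=> c00 K0.
have Lb phi r : 0 <= r -> bounded_by phi r -> bounded_functions (fun s => phi (F s) : R[i]).
  by move=> r0 phir; exact: bounded_functional_comp phir.
pose V := {ffun option 'I_n -> R[i]^o}.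
pose adm (z : {linear X -> R[i]^o} * R) := 0 <= z.2 /\ bounded_by z.1 z.2.
(* The cost of approximating the scalars [g] by [L phi] and the [phi (x i)]: the bound on [phi] is
   charged with weight [c0], the errors at the [x i] with weight [K]. Its infimum [dist] is a
   seminorm because these values are linear in [phi]. *)
pose cost (g : V) (z : {linear X -> R[i]^o} * R) : R := c0 * z.2 +
  normc (g None - L z.1) + K * \sum_i normc (g (Some i) - z.1 (x i)).
pose dist g := inf [set cost g z | z in adm].
have cost_ge0 g z : adm z -> 0 <= cost g z.
  move=> [z0 _]; rewrite /cost !addr_ge0 ?normc_ge0 ?mulr_ge0 ?(ltW c00) ?(ltW K0) //.
  by apply: sumr_ge0 => i _; exact: normc_ge0.
pose zero : {linear X -> R[i]^o} := \0.
have adm0 : adm (zero, 0).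
  by split=> // v; rewrite mul0r -[normc _]/(normc (0 : R[i])) Normc.normc0.
have hinf g : has_inf [set cost g z | z in adm].
  split; first by exists (cost g (zero, 0)); exists (zero, 0).
  by exists 0 => _ [z az <-]; exact: cost_ge0.
have dist_le g z : adm z -> dist g <= cost g z.
  by move=> az; apply: ge_inf; [case: (hinf g) | exists z].
have dist_lt g r : dist g < r -> exists2 z, adm z & cost g z < r.
  move=> gr; have r0 : 0 < r - dist g by rewrite subr_gt0.
  have [_ [z az <-]] := inf_adherent r0 (hinf g).
  by rewrite -/(dist g) subrKC => h; exists z.
have dist_ge0 g : 0 <= dist g.
  apply: lb_le_inf; first by case: (hinf g).
  by move=> _ [z az <-]; exact: cost_ge0.
have dist_seminorm : seminorm dist.
  apply: seminormI => // [u v|c u]; apply/ler_addgt0Pr => e e0.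
    have e2 : 0 < e / 2 by rewrite divr_gt0.
    have [[f a] [/= a0 fa] hfa] : exists2 z, adm z & cost u z < dist u + e / 2.
      by apply: dist_lt; rewrite ltrDl.
    have [[h b] [/= b0 hb] hhb] : exists2 z, adm z & cost v z < dist v + e / 2.
      by apply: dist_lt; rewrite ltrDl.
    pose fh : {linear X -> R[i]^o} := f \+ h.
    have az : adm (fh, a + b).
      split=> [|w] /=; first by rewrite addr_ge0.
      by apply: le_trans (normcD _ _) _; rewrite mulrDl lerD.
    apply: le_trans (dist_le _ _ az) _.
    suff : cost (u + v) (fh, a + b) <= cost u (f, a) + cost v (h, b) by lra.
    rewrite /cost /= mulrDr.
    have -> : L fh = L f + L h by rewrite -(meanD mm) //; [exact: Lb fa | exact: Lb hb].
    have h1 : normc ((u + v) None - (L f + L h)) <= normc (u None - L f) + normc (v None - L h).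
      by apply: le_trans (normcD _ _); rewrite ffunE opprD addrACA.
    have h2 : K * \sum_i normc ((u + v) (Some i) - (f (x i) + h (x i))) <=
        K * \sum_i normc (u (Some i) - f (x i)) + K * \sum_i normc (v (Some i) - h (x i)).
      rewrite -mulrDr ler_wpM2l ?(ltW K0) // -big_split /=; apply: ler_sum => i _.
      by apply: le_trans (normcD _ _); rewrite ffunE opprD addrACA.
    lra.
  pose c1 := normc c + 1.
  have c10 : 0 < c1 by rewrite ltr_wpDl ?normc_ge0.
  have ec : 0 < e / c1 by rewrite divr_gt0.
  have [[f a] [/= a0 fa] hfa] : exists2 z, adm z & cost u z < dist u + e / c1.
    by apply: dist_lt; rewrite ltrDl.
  have [h hb hE] := bounded_by_scale c fa.
  have az : adm (h, normc c * a) by split => //=; rewrite mulr_ge0 ?normc_ge0.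
  apply: le_trans (dist_le _ _ az) _.
  have -> : cost (c *: u) (h, normc c * a) = normc c * cost u (f, a).
    rewrite /cost /= !mulrDr mulrCA; congr (_ + _ + _).
      rewrite -Normc.normcM mulrBr ffunE; congr (normc (_ - _)).
      rewrite -(meanZ TT mm); last exact: Lb fa.
      by congr mu; apply/funext => s.
    rewrite mulrCA; congr (_ * _); rewrite mulr_sumr; apply: eq_bigr => i _.
    by rewrite -Normc.normcM mulrBr ffunE hE.
  apply: (@le_trans _ _ (normc c * (dist u + e / c1))).
    by rewrite ler_wpM2l ?normc_ge0 // ltW.
  rewrite mulrDr lerD2l mulrA ler_pdivrMr // mulrC ler_wpM2l ?(ltW e0) //.
  by rewrite lerDl.
pose delta (o : option 'I_n) : V := [ffun o' => (o' == o)%:R].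
have [psi [psid psiE]] := hahn_banach dist_seminorm.1 dist_seminorm.2 (delta None).
pose a := dist (delta None).
have deltaE (c : R[i]) o o' : (c *: delta o) o' = c * (o' == o)%:R by rewrite !ffunE.
have coord (g : V) : g = g None *: delta None + \sum_i g (Some i) *: delta (Some i).
  apply/ffunP => o; rewrite ffunE sum_ffunE deltaE; under eq_bigr do rewrite deltaE.
  case: o => [i|]; last first.
    by rewrite eqxx mulr1 big1 ?addr0 // => j _; rewrite mulr0.
  rewrite mulr0 add0r (bigD1 i) //= eqxx mulr1 big1 ?addr0 // => j ji.
  by rewrite -[Some i == _]/(i == j) eq_sym (negbTE ji) mulr0.
have psi_coord (g : V) : psi g = g None * a%:C + \sum_i g (Some i) * psi (delta (Some i)).
  by rewrite {1}(coord g) linearD linearZ linear_sum /= psiE -/a;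
    under eq_bigr do rewrite linearZ.
(* If [a] is at least one half, [v] is read off [psi]: on the family of values of [phi], [psi] is at
   most [c0] in modulus, and dividing by [a] costs a factor [2]. Otherwise some [phi] has cost below
   one half, and each term of the cost yields one of the required properties. *)
have [ha|ha] := lerP 2^-1 a.
  left; exists (- \sum_i (psi (delta (Some i)) / a%:C) *: x i) => phi phi1.
  have a0 : 0 < a by apply: lt_le_trans ha; rewrite invr_gt0.
  have aC0 : a%:C != 0 :> R[i] by rewrite -[0]/(0%:C) (inj_eq (@complexI R)) gt_eqF.
  pose g : V := [ffun o => if o is Some i then phi (x i) else L phi].
  have h1 : normc (psi g) <= c0.
    apply: le_trans (psid g) _; apply: le_trans (dist_le g (phi, 1) _) _ => //.
    rewrite /cost /= ffunE subrr Normc.normc0 addr0 mulr1 big1 ?mulr0 ?addr0 // => i _.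
    by rewrite ffunE subrr Normc.normc0.
  have -> : phi (- \sum_i (psi (delta (Some i)) / a%:C) *: x i) - L phi = - (psi g / a%:C).
    rewrite psi_coord linearN linear_sum /= ffunE mulrDl mulfK // opprD addrC; congr (_ - _).
    rewrite mulr_suml; apply: eq_bigr => i _.
    by rewrite linearZ /= ffunE -[LHS]/(_ * _) mulrC mulrA.
  rewrite normcN Normc.normcM Normc.normcV normc_real gtr0_norm // ler_pdivrMr //.
  apply: le_trans h1 _; rewrite mulrC mulrA ler_peMl ?(ltW c00) //; lra.
right; have [[phi r] [/= r0 phir] hc] := dist_lt _ _ ha; rewrite /cost /= in hc.
have d0 : delta None None = 1 by rewrite ffunE.
have s0 : 0 <= \sum_i normc (delta None (Some i) - phi (x i)).
  by apply: sumr_ge0 => i _; exact: normc_ge0.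
have t1 : 0 <= c0 * r by rewrite mulr_ge0 // ltW.
have t2 : 0 <= K * \sum_i normc (delta None (Some i) - phi (x i)) by rewrite mulr_ge0 // ltW.
have t3 := normc_ge0 (delta None None - L phi).
exists phi; split.
- move=> v; apply: le_trans (phir v) _; rewrite ler_wpM2r ?nrm_ge0 //.
  rewrite invfM ler_pdivlMr // mulrC; lra.
- have : normc (1 : R[i]) <= normc (1 - L phi) + normc (L phi).
    by apply: le_trans (normcD _ _); rewrite subrK.
  rewrite Normc.normc1; rewrite d0 in hc t3; lra.
- move=> i; rewrite -[K^-1]mul1r ler_pdivlMr // mulrC.
  have : normc (phi (x i)) <= \sum_i normc (delta None (Some i) - phi (x i)).
    rewrite (bigD1 i) //= ffunE sub0r normcN lerDl.
    by apply: sumr_ge0 => j _; exact: normc_ge0.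
  move=> /(ler_wpM2l (ltW K0)); lra.
Qed.

End HellyAlternative.

Section SeparableWeaklyContinuous.
Context {R : realType} {S : preTopologicalSemigroupType} {X : operatorSpaceType R}.

Lemma weakly_continuous_functional (T : topologicalType) (g : T -> X)
    (phi : {linear X -> R[i]^o}) (K : R) :
  weakly_continuous g -> bounded_by phi K -> continuous (phi \o g : T -> R[i]^o).
Proof.
move=> gc phiK; have phic : continuous phi.
  apply/continuous_functionalP; exists `|K| => // v.
  by apply: le_trans (phiK v) _; rewrite ler_wpM2r ?nrm_ge0 // ler_norm.
pose f : bounded_functional X := exist _ phi phic.
have c2 : continuous (@weak_eval R X : initial_topology (@weak_eval R X) -> _).
  exact: initial_continuous.
have c3 : continuous (fun h : prod_topology (fun _ : bounded_functional X => R[i]^o) => h f).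
  exact: (@proj_continuous {classic (bounded_functional X)} (fun=> R[i]^o) f).
by move=> t; exact: (continuous_comp (continuous_comp (gc t) (c2 _)) (c3 _)).
Qed.

Lemma separable_sequence (x0 : X) : separable X ->
  exists x : nat -> X, forall u (r : R), 0 < r -> exists i, nrm (u - x i) < r.
Proof.
move=> [A /countable_injP[f finj] dA].
(* [x0] fills the indices that code no point of [A]. *)
pose x n := if pselect (exists2 a, A a & f a = n) is left h then sval (cid2 h) else x0.
exists x => u r r0.
have [|a [ba Aa]] := dA (ball u r%:C) _ (ball_open _ _ ).
  by exists u; apply: ballxx; rewrite ltcR.
exists (f a); rewrite /x; case: pselect => [h|[]]; last by exists a.
case: cid2 => b Ab /= fab; have -> : b = a by apply: finj => //; exact: mem_set.
by move: ba; rewrite -ball_normE /= normE ltcR.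
Qed.

Variables (mu : (S -> R[i]) -> R[i]) (F : S -> X) (B : R).
Hypothesis mm : mean_on (@bounded_functions R S) mu.
Hypothesis FB : forall s, nrm (F s) <= B.

(* Bounded functionals tending pointwise to 0 have means tending to 0, so the
   second branch of [helly_alternative] cannot occur along a dense sequence. *)
Lemma separable_barycenter : separable X -> compact [set: S] ->
  weakly_continuous F ->
  exists y, forall (phi : {linear X -> R[i]^o}) K, bounded_by phi K ->
     phi y = mu (fun s => phi (F s)).
Proof.
move=> sepX cS Fw; apply: (barycenter_limit mm FB) => r r0.
apply: contrapT => nv.
have [x xdense] := separable_sequence 0 sepX.
pose c0 := r / 2; have c00 : 0 < c0 by rewrite divr_gt0.
have c2r : 2 * c0 = r by rewrite mulrC divfK.
(* The first alternative is excluded by [nv], as [2 * c0] is [r]; the second is used with the first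
   [n] points of the dense sequence and weight [n + 1]. *)
have exphi n : exists phi : {linear X -> R[i]^o}, [/\ bounded_by phi r^-1,
    2^-1 <= normc (mu (fun s => phi (F s))) &
    forall i, (i < n)%N -> normc (phi (x i)) <= n.+1%:R^-1].
  have [[v hv]|[phi]] := helly_alternative mm FB (fun i : 'I_n => x i) c00 (ltr0Sn R n).
    by case: nv; exists v => phi /hv; rewrite c2r.
  by rewrite c2r => -[p1 p2 p3]; exists phi; split=> // i ilt; exact: (p3 (Ordinal ilt)).
pose phi n := sval (cid (exphi n)).
have phib n : bounded_by (phi n) r^-1 by rewrite /phi; case: cid => ? [].
have phim n : 2^-1 <= normc (mu (fun s => phi n (F s))) by rewrite /phi; case: cid => ? [].
have phix n i : (i < n)%N -> normc (phi n (x i)) <= n.+1%:R^-1.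
  by rewrite /phi; case: cid => ? /= [_ _]; apply.
have lim0 u (d : R) : 0 < d -> exists N, forall n, (N <= n)%N -> normc (phi n u) < d.
  move=> d0; have rd : 0 < r * (d / 2) by rewrite mulr_gt0 // divr_gt0.
  have [i hi] := xdense u _ rd.
  exists (maxn i.+1 (Num.trunc (d / 2)^-1)) => n; rewrite geq_max => /andP[hin hn].
  have -> : phi n u = phi n (u - x i) + phi n (x i) by rewrite linearB subrK.
  apply: le_lt_trans (normcD _ _) _; rewrite [ltRHS](splitr d) ltr_leD //.
    apply: le_lt_trans (phib n _) _; rewrite ltr_pdivrMl //.
  apply: le_trans (phix n i hin) _; rewrite invf_ple ?posrE ?divr_gt0 //.
  apply: (@le_trans _ _ (Num.trunc (d / 2)^-1).+1%:R); last by rewrite ler_nat.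
  by apply: ltW; apply: truncnS_gt.
have r1 : 0 < r^-1 by rewrite invr_gt0.
have Tphi n : bounded_functions (fun s => phi n (F s) : R[i]).
  exact: (bounded_functional_comp FB (ltW r1) (phib n)).
pose A n := [set s | 4^-1 <= normc (phi n (F s))].
pose K := r^-1 * (`|B| + 1).
have K0 : 0 < K by rewrite mulr_gt0 // ltr_wpDl.
have phiK n s : normc (phi n (F s)) <= K.
  apply: le_trans (phib n _) _; rewrite ler_wpM2l ?(ltW r1) //.
  by apply: le_trans (FB s) _; rewrite (le_trans (ler_norm B)) // lerDl.
have Aclosed n : closed (A n).
  move=> s sA; rewrite /A /= leNgt; apply/negP => hs.
  pose e := (4^-1 - normc (phi n (F s))) / 2.
  have e0 : 0 < e by rewrite divr_gt0 // subr_gt0.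
  have /cvg_scalarP/(_ e e0)/sA[u [Au /= hu]] :
    {for s, continuous (phi n \o F : S -> R[i]^o)}
    by exact: (weakly_continuous_functional Fw (phib n)).
  have := normcD (phi n (F u) - phi n (F s)) (phi n (F s)); rewrite subrK.
  by rewrite /A /= in Au; rewrite /e in hu; lra.
(* The mean has modulus at least one half, and the part off [A n] contributes at most one quarter;
   on [A n] the function is at most [K]. *)
have Am n : 4^-1 / K <= mean_charge mu (A n).
  pose g1 : S -> R[i] := fun s => if `[< A n s >] then phi n (F s) else 0.
  pose g2 : S -> R[i] := fun s => if `[< A n s >] then 0 else phi n (F s).
  have b1 : bounded_functions g1.
    by exists K => s; rewrite /g1; case: asboolP; rewrite ?Normc.normc0 // ltW.
  have b2 : bounded_functions g2.
    by exists K => s; rewrite /g2; case: asboolP; rewrite ?Normc.normc0 // ltW.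
  have e12 : mu (fun s => phi n (F s)) = mu g1 + mu g2.
    rewrite -(meanD mm) //; congr mu; apply/funext => s; rewrite /g1 /g2.
    by case: asboolP; rewrite ?addr0 ?add0r.
  have h1 : normc (mu g1) <= K * mean_charge mu (A n).
    apply: (mean_le_charge mm) => // s; rewrite /g1; case: asboolP => //.
    by rewrite Normc.normc0 ltW.
  have h2 : normc (mu g2) <= 4^-1.
    case: (mm) => _ mb _; apply: mb => // s; rewrite /g2; case: asboolP => [_|/negP].
      by rewrite Normc.normc0 invr_ge0.
    by rewrite -ltNge => /ltW.
  have := phim n; rewrite e12 => h3; have h4 := normcD (mu g1) (mu g2).
  rewrite ler_pdivrMr // mulrC; lra.
have d0 : 0 < 4^-1 / K by rewrite divr_gt0 // invr_gt0.
have [k [jk kP]] := finitely_additive_recurrence (mean_charge_set0 mm) (mean_charge_ge0 mm)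
  (mean_charge_le1 mm) (mean_charge_mono mm) (mean_charge_modular mm) d0 Am.
(* [s j] lies in the closed sets [A (k i)] for [i <= j], so a cluster point [p] lies in all of them,
   against convergence to [0] at [F p]. *)
pose s j := sval (cid (kP j)).
have sP j i : (i <= j)%N -> A (k i) (s j) by rewrite /s; case: cid => ? /= h; exact: h.
have [p _ ps] := compact_seq_cluster (t := s) cS (fun=> I).
have Ap i : A (k i) p.
  apply: Aclosed => U /ps/(_ i)[j ij Uj]; exists (s j); split => //; exact: sP.
have q4 : (0 : R) < 4^-1 by rewrite invr_gt0.
have [n0 hn0] := lim0 (F p) _ q4.
by have := Ap n0; rewrite /A /= leNgt hn0.
Qed.

End SeparableWeaklyContinuous.

Lemma separable_weakly_continuous_projection (R : realType)
    (S : preTopologicalSemigroupType) (X : operatorSpaceType R)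
    (alpha : S -> {linear X -> X}) :
  operator_S_space alpha -> separable X -> compact [set: S] ->
  amenable_semigroup R S -> (forall x, weakly_continuous (fun s => alpha s x)) ->
  has_projection alpha.
Proof.
move=> alphaS sepX cS amS ac; have [mu mm mI] := amenable_mean (unital_bounded R S) amS.
have [C [C0 EC aC]] := action_bound alphaS (mean_nonempty (unital_bounded R S) mm).
apply: (barycenter_projection alphaS mm) => [x|].
  exact: (separable_barycenter mm (fun s => action_nrm aC s x)).
exact: (amenable_action_invariant alphaS mm mI).
Qed.

(** * Invariant means on compact groups *)

Lemma ultrafilter_cvg (T : Type) (U : set_system T) (Y : topologicalType) (K : set Y)
  (g : T -> Y) : UltraFilter U -> compact K -> U (g @^-1` K) -> exists p : Y, g @ U --> p.
Proof.
move=> UU cK UK; have [p [_ cp]] := cK (g @ U) _ UK.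
exists p => W pW; have [//|nW] := in_ultra_setVsetC (g @^-1` W) UU.
by have [y []] := cp (~` W) W nW pW.
Qed.

Section RightAverages.
Context {R : realType} {S : semigroupType}.

(** Averaging right translates commutes with left translation. Repetitions in the list are allowed,
    so that a composition of averages is the average over the products. *)
Definition avg (a : seq S) (f : S -> R) (t : S) : R :=
  (size a)%:R^-1 * \sum_(x <- a) f (t * x)%g.

Lemma avg_le a f t (C : R) : a != [::] -> (forall s, f s <= C) -> avg a f t <= C.
Proof.
move=> a0 fC; rewrite /avg ler_pdivrMl ?ltr0n ?lt0n ?size_eq0 //.
elim: a {a0} => [|x a IH]; first by rewrite big_nil mul0r.
by rewrite big_cons /= -natr1 mulrDl mul1r addrC lerD.
Qed.

Lemma avg_ge a f t (C : R) : a != [::] -> (forall s, C <= f s) -> C <= avg a f t.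
Proof.
move=> a0 fC; rewrite /avg ler_pdivlMl ?ltr0n ?lt0n ?size_eq0 //.
elim: a {a0} => [|x a IH]; first by rewrite big_nil mul0r.
by rewrite big_cons /= -natr1 mulrDl mul1r addrC lerD.
Qed.

Lemma avg_comb a (k : R) f g t : avg a (fun s => k * f s + g s) t = k * avg a f t + avg a g t.
Proof.
by rewrite /avg big_split /= -mulr_sumr mulrDr mulrCA.
Qed.

Lemma avg_const a (k : R) t : a != [::] -> avg a (fun=> k) t = k.
Proof. by move=> a0; apply/eqP; rewrite eq_le avg_le //= avg_ge. Qed.

Lemma avg_avg a b f t : avg a (avg b f) t = avg [seq (x * y)%g | x <- a, y <- b] f t.
Proof.
rewrite /avg size_allpairs natrM invfM -mulr_sumr mulrA; congr (_ * _).
rewrite big_allpairs_dep /=; apply: eq_bigr => x _; apply: eq_bigr => y _.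
by rewrite mulgA.
Qed.

Lemma avg_dist a f (t t' : S) (d : R) : a != [::] ->
  (forall x, `|f (t * x)%g - f (t' * x)%g| <= d) -> `|avg a f t - avg a f t'| <= d.
Proof.
move=> a0 fd; rewrite /avg -mulrBr -sumrB normrM ger0_norm ?invr_ge0 ?ler0n //.
rewrite ler_pdivrMl ?ltr0n ?lt0n ?size_eq0 //.
apply: le_trans (ler_norm_sum _ _ _) _.
elim: a {a0} => [|x a IH]; first by rewrite big_nil mul0r.
by rewrite big_cons /= -natr1 mulrDl mul1r addrC lerD.
Qed.

End RightAverages.

Section CompactGroupMean.
Context {R : realType} {S : preTopologicalSemigroupType}.
Variables (e : S) (inv : S -> S).
Hypotheses (mul1 : left_id e *%g) (mulx1 : right_id e *%g).
Hypotheses (mulV : left_inverse e inv *%g) (mulxV : right_inverse e inv *%g).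
Hypotheses (mul_cont : continuous (fun p : S * S => (p.1 * p.2)%g)).
Hypotheses (inv_cont : continuous inv) (cS : compact [set: S]).

Definition within_width (f : S -> R) (w : R) := exists k, forall t, k <= f t <= k + w.

(** A modulus of continuity that every right average inherits with the same neighbourhoods [V]. *)
Definition translation_continuous (f : S -> R) := (exists w, within_width f w) /\
  forall d : R, 0 < d -> exists2 V, nbhs e V &
    forall v, V v -> forall t, `|f (v * t)%g - f t| <= d.

Lemma within_width_avg a f w : a != [::] -> within_width f w -> within_width (avg a f) w.
Proof.
move=> a0 [k kf]; exists k => t; rewrite avg_le ?avg_ge // => s; by case/andP: (kf s).
Qed.

Lemma translation_continuous_avg a f : a != [::] -> translation_continuous f ->
  translation_continuous (avg a f).
Proof.
move=> a0 [[w fw] fc]; split; first by exists w; exact: within_width_avg.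
move=> d d0; have [V Ve VP] := fc d d0; exists V => // v Vv t.
by apply: avg_dist => // x; rewrite -mulgA; exact: VP.
Qed.

(* Among the translates [t x], [x] in a finite set [a] depending only on the
   modulus of continuity of [f], one lies near [e]; averaging over [a] thus
   moves the upper or the lower bound of [f] closer to [f e]. *)
Lemma avg_contraction f (d : R) : translation_continuous f -> 0 < d ->
  exists2 h : R, 0 < h & exists2 a : seq S, a != [::] & forall b w, b != [::] ->
    4 * d <= w -> within_width (avg b f) w -> within_width (avg a (avg b f)) (w - h).
Proof.
move=> [_ fc] d0; have [V Ve VP] := fc d d0.
have [s _|l lP] := @compact_finite_cover S setT (fun s => [set u | V (u * inv s)%g]) cS.
  have hc : continuous (fun u => (u * inv s)%g).
    by apply: (continuous_mul mul_cont) => y; [exact: cvg_id | exact: cvg_cst].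
  by apply: (hc s); rewrite /= mulxV.
pose a := map inv l.
have [s0 s0l _] := lP e I.
have a0 : a != [::] by rewrite /a; case: (l) s0l.
have sa : 0 < (size a)%:R :> R by rewrite ltr0n lt0n size_eq0.
exists (d / (size a)%:R); first by rewrite divr_gt0.
exists a => // b w b0 dw [k kg]; set g := avg b f in kg *.
have gV v : V v -> `|g v - g e| <= d.
  move=> Vv; rewrite -[v in g v]mulx1; apply: avg_dist => // x.
  by rewrite -mulgA mul1; exact: VP.
have hit t : exists2 x, x \in a & `|g (t * x)%g - g e| <= d.
  have [s sl Vs] := lP t I; exists (inv s); first exact: map_f.
  exact: gV.
have splita t x : x \in a -> \sum_(y <- a) g (t * y)%g =
    g (t * x)%g + \sum_(y <- rem x a) g (t * y)%g.
  by move=> xa; rewrite (perm_big _ (perm_to_rem xa)) big_cons.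
have rem_le t x : \sum_(y <- rem x a) g (t * y)%g <= (size (rem x a))%:R * (k + w).
  elim: (rem x a) => [|y c IH]; first by rewrite big_nil mul0r.
  rewrite big_cons /= -natr1 mulrDl mul1r addrC lerD //.
  by case/andP: (kg (t * y)%g).
have rem_ge t x : (size (rem x a))%:R * k <= \sum_(y <- rem x a) g (t * y)%g.
  elim: (rem x a) => [|y c IH]; first by rewrite big_nil mul0r.
  rewrite big_cons /= -natr1 mulrDl mul1r addrC lerD //.
  by case/andP: (kg (t * y)%g).
have size_rem' x : x \in a -> (size (rem x a))%:R = (size a)%:R - 1 :> R.
  move=> xa; rewrite size_rem // -subn1 natrB //.
  by rewrite lt0n size_eq0.
have avgE t : avg a g t = (size a)%:R^-1 * \sum_(y <- a) g (t * y)%g by [].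
have hN : (size a)%:R * (d / (size a)%:R) = d by rewrite mulrC divfK // gt_eqF.
(* If [g e] is in the lower half, the translate near [e] is at most [k + w / 2 + d <= k + w - d], as
   [4 * d <= w]; its weight in the average turns the gain [d] into [d / size a]. The upper half is
   symmetric. *)
have [ge|ge] := lerP (g e) (k + w / 2).
  exists k => t; rewrite avg_ge //=; last by move=> s; case/andP: (kg s).
  have [x xa] := hit t; rewrite ler_norml => /andP[_ hx].
  rewrite avgE ler_pdivrMl // (splita t x xa).
  have := rem_le t x; rewrite (size_rem' x xa) => h.
  rewrite addrA mulrBr hN; lra.
exists (k + d / (size a)%:R) => t; apply/andP; split; last first.
  rewrite (_ : _ + (w - _) = k + w); last by ring.
  by rewrite avg_le // => s; case/andP: (kg s).
have [x xa] := hit t; rewrite ler_norml => /andP[hx _].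
rewrite avgE ler_pdivlMl // (splita t x xa) mulrDr hN.
have := rem_ge t x; rewrite (size_rem' x xa) => h; lra.
Qed.

Lemma avg_almost_constant f (r : R) : translation_continuous f -> 0 < r ->
  exists2 a, a != [::] & within_width (avg a f) r.
Proof.
move=> fc r0; have [[w0 fw0] _] := fc.
have d0 : 0 < r / 4 by rewrite divr_gt0.
have [h h0 [c c0 cP]] := avg_contraction fc d0.
(* The gain [h] is the same in each round because [c] and [h] depend on [f] and [r], not on the
   averages already taken; the maximum with [r] stops the iteration once the width is small. *)
have iter n : exists2 a, a != [::] & within_width (avg a f) (Num.max r (w0 - n%:R * h)).
  have widen g w w' : w <= w' -> within_width g w -> within_width g w'.
    move=> ww [k kg]; exists k => t; have /andP[-> /= h1] := kg t.
    by apply: le_trans h1 _; rewrite lerD2l.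
  elim: n => [|n [a a0 fa]].
    exists [:: e] => //; apply: (widen _ w0); last exact: within_width_avg.
    by rewrite mul0r subr0 le_max lexx orbT.
  have [wr|rw] := lerP (w0 - n%:R * h) r.
    exists a => //; apply: widen fa; rewrite (max_idPl wr).
    by rewrite le_max lexx.
  exists [seq (x * y)%g | x <- c, y <- a].
    by case: (c) c0 (a) a0 => [//|? ?] _ [].
  rewrite [X in within_width X _](_ : _ = avg c (avg a f)); last first.
    by apply/funext => t; rewrite avg_avg.
  have {}fa : within_width (avg a f) (w0 - n%:R * h).
    by move: fa; rewrite (max_idPr (ltW rw)).
  apply: widen (cP a _ a0 _ fa); last by rewrite mulrC divfK // ltW.
  by rewrite le_max -natr1 mulrDl mul1r opprD addrA lexx orbT.
have [a a0 fa] := iter (Num.trunc ((w0 - r) / h)).+1; exists a => //.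
move: fa; rewrite (max_idPl _) // lerBlDr -lerBlDl -ler_pdivrMr //.
by apply: ltW; exact: truncnS_gt.
Qed.

(** The functions are treated in turn: further averaging does not spoil the width reached for the
    earlier ones. *)
Lemma avg_almost_constant_seq (fs : seq (S -> R)) (r : R) : 0 < r ->
  (forall f, List.In f fs -> translation_continuous f) ->
  exists2 a, a != [::] & forall f, List.In f fs -> within_width (avg a f) r.
Proof.
move=> r0; elim: fs => [|f fs IH] fsc; first by exists [:: e].
have [a a0 fa] := IH (fun g gfs => fsc g (or_intror gfs)).
have [b b0 fb] : exists2 b, b != [::] & within_width (avg b (avg a f)) r.
  by apply: avg_almost_constant => //; apply: translation_continuous_avg => //; apply: fsc; left.
exists [seq (x * y)%g | x <- b, y <- a].
  by case: (b) b0 (a) a0 => [//|? ?] _ [].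
move=> g gin; rewrite [X in within_width X _](_ : _ = avg b (avg a g)); last first.
  by apply/funext => t; rewrite avg_avg.
by case: gin => [<-//|gin]; apply: within_width_avg => //; exact: fa.
Qed.

(* The mean is a limit, along an ultrafilter, of finite right averages. *)
Lemma compact_group_real_mean : exists m : (S -> R) -> R,
  [/\ forall k f g (M N : R), (forall s, `|f s| <= M) -> (forall s, `|g s| <= N) ->
        m (fun s => k * f s + g s) = k * m f + m g,
      forall f (M : R), (forall s, `|f s| <= M) -> `|m f| <= M,
      m (cst 1) = 1 &
      forall t f, translation_continuous f -> m (fun s => f (t * s)%g) = m f].
Proof.
pose D := [set z : seq (S -> R) * R | 0 < z.2 /\
  forall f, List.In f z.1 -> translation_continuous f].
pose Bs (z : seq (S -> R) * R) := [set a : seq S | a != [::] /\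
  forall f, List.In f z.1 -> within_width (avg a f) z.2].
have widen g w w' : w <= w' -> within_width g w -> within_width g w'.
  move=> ww [k kg]; exists k => t; have /andP[-> /= h1] := kg t.
  by apply: le_trans h1 _; rewrite lerD2l.
have PF : ProperFilter (filter_from D Bs).
  apply: filter_from_proper; last first.
    by move=> [fs r] [r0 fc]; have [a a0 fa] := avg_almost_constant_seq r0 fc; exists a.
  apply: filter_from_filter; first by exists ([::], 1); split.
  move=> [fs r] [gs q] [/= r0 fc] [/= q0 gc]; exists (fs ++ gs, Num.min r q).
    split; first by rewrite lt_min r0.
    by move=> f /= fin; have [/fc|/gc] := List.in_app_or _ _ _ fin.
  move=> a [a0 h]; split; split=> // f fin.
    by apply: widen (h f _); [rewrite ge_min lexx | apply: List.in_or_app; left].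
  by apply: widen (h f _); [rewrite ge_min lexx orbT | apply: List.in_or_app; right].
have [U [UU sub]] := ultraFilterLemma PF.
have Une : U [set a | a != [::]].
  apply: sub; exists ([::], 1); first by split.
  by move=> a [].
pose av f (a : seq S) : R := avg a f e.
have avM f (M : R) a : a != [::] -> (forall s, `|f s| <= M) -> - M <= av f a <= M.
  move=> a0 fM; rewrite avg_ge ?avg_le // => s; have := fM s; rewrite ler_norml => /andP[] //.
have cvm f (M : R) : (forall s, `|f s| <= M) -> cvg (av f @ U).
  move=> fM; have [|p Up] := ultrafilter_cvg UU (@segment_compact R (- M) M) (g := av f).
    by apply: filterS Une => a a0; rewrite /= in_itv /= avM.
  by apply/cvg_ex; exists p.
pose m f := lim (av f @ U).
have bndm f (M : R) : (forall s, `|f s| <= M) -> `|m f| <= M.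
  move=> fM; have cf := cvm f M fM; rewrite ler_norml; apply/andP; split.
    by apply: (limr_ge cf); apply: filterS Une => a a0; case/andP: (avM _ _ _ a0 fM).
  by apply: (limr_le cf); apply: filterS Une => a a0; case/andP: (avM _ _ _ a0 fM).
have linm k f g (M N : R) : (forall s, `|f s| <= M) -> (forall s, `|g s| <= N) ->
    m (fun s => k * f s + g s) = k * m f + m g.
  move=> fM gN; apply: cvg_lim => //.
  rewrite (_ : av _ = (fun a => k * av f a + av g a)); last first.
    by apply/funext => a; exact: avg_comb.
  by apply: cvgD; [apply: cvgMr; exact: (cvm f M) | exact: (cvm g N)].
exists m; split=> //.
  apply: cvg_lim => //; apply: (cvg_trans _ (cvg_cst (1 : R) (F := U))).
  by apply: near_eq_cvg; apply: filterS Une => a a0; rewrite /av avg_const.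
move=> t f fc; have [[w [k kf]] _] := fc.
pose M := `|k| + `|w|.
have fM s : `|f s| <= M.
  have /andP[h1 h2] := kf s; rewrite ler_norml /M.
  have := ler_norm w; have := ler_norm k; have := ler_norm (- k); rewrite normrN.
  have := normr_ge0 w; move=> *; apply/andP; split; lra.
pose g s := -1 * f s + f (t * s)%g.
suff g0 : m g = 0.
  have := linm (-1) f (fun s => f (t * s)%g) M M fM (fun s => fM _).
  by rewrite -/g g0 mulN1r => /eqP; rewrite eq_sym addrC subr_eq0 => /eqP.
apply/eqP; rewrite -normr_eq0 eq_le normr_ge0 andbT; apply/ler_addgt0Pr => r r0.
rewrite add0r.
have gM s : `|g s| <= M + M.
  by rewrite /g mulN1r; apply: le_trans (ler_normD _ _) _; rewrite normrN lerD.
have Ur : U (Bs ([:: f], r)).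
  by apply: sub; exists ([:: f], r) => //; split=> // h /= [<-|].
have avg_g a : Bs ([:: f], r) a -> - r <= av g a <= r.
  move=> [a0 /(_ f (or_introl erefl))[k' kav]].
  (* The averages at [e] of [f] and of its translate are the values at [e] and at [t] of one almost
     constant function. *)
  rewrite /av /g avg_comb mulN1r.
  have -> : avg a (fun s => f (t * s)%g) e = avg a f t.
    by rewrite /avg; congr (_ * _); apply: eq_bigr => x _; rewrite mul1.
  have /andP[h1 h2] := kav t; have /andP[h3 h4] := kav e.
  by rewrite /= in h1 h2 h3 h4; apply/andP; split; lra.
have cg := cvm g _ gM; rewrite ler_norml; apply/andP; split.
  by apply: (limr_ge cg); apply: filterS Ur => a /avg_g/andP[].
by apply: (limr_le cg); apply: filterS Ur => a /avg_g/andP[].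
Qed.

Lemma translation_continuous_comp (f : S -> R[i]) (p : R[i] -> R) :
  (forall z w, p (z + w) = p z + p w) -> (forall z, `|p z| <= normc z) ->
  bounded_functions f -> continuous (f : S -> R[i]^o) -> translation_continuous (p \o f).
Proof.
move=> pD pn [M fM] fc.
have pB z w : p (z - w) = p z - p w by have := pD (z - w) w; rewrite subrK => ->; rewrite addrK.
split.
  exists (M + M), (- M) => t; have := le_trans (pn (f t)) (fM t).
  by rewrite ler_norml /= addrA addNr add0r.
move=> d d0.
have hc : continuous (fun q : S * S => (f (q.2 * q.1)%g : R[i]^o)).
  move=> q; apply: (@continuous_comp _ _ _ (fun q : S * S => (q.2 * q.1)%g)); last exact: fc.
  by apply: (continuous_mul mul_cont) => z; [exact: cvg_snd | exact: cvg_fst].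
(* Compactness of [S] makes the neighbourhood of [e] uniform in [t]. *)
have near_e : \forall v \near e, [set: S] `<=` (fun t => normc (f (v * t)%g - f t) <= d).
  have /compact_near_coveringP/(_ S (nbhs e)) := cS; apply => t _.
  have d2 : 0 < d / 2 by rewrite divr_gt0.
  have h1 : \forall q \near (t, e), normc (f (q.2 * q.1)%g - f t) <= d / 2.
    have /cvg_scalarP/(_ _ d2) := hc (t, e).
    by rewrite /= mul1.
  have h2 : \forall q \near (t, e), normc (f q.1 - f t) <= d / 2.
    have /cvg_scalarP/(_ _ d2) h := fc t.
    exact: (@cvg_fst _ _ (nbhs t) (nbhs e) _ _ h).
  apply: filterS2 h1 h2 => -[u v] /= h1 h2.
  have -> : f (v * u)%g - f u = (f (v * u)%g - f t) - (f u - f t) by ring.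
  by apply: le_trans (normcB _ _) _; rewrite [leRHS](splitr d) lerD.
exists (fun v => [set: S] `<=` (fun t => normc (f (v * t)%g - f t) <= d)) => // v hv t.
by rewrite /= -pB; apply: le_trans (pn _) (hv t I).
Qed.

End CompactGroupMean.

Section CompactGroupProjection.
Context {R : realType} {S : preTopologicalSemigroupType}.

(** The real mean acts on real and imaginary parts; rotating its value to a real number recovers the
    sup bound without loss of constant. *)
Lemma compact_group_mean : topological_group S -> compact [set: S] ->
  exists2 mu : (S -> R[i]) -> R[i], mean_on (@bounded_functions R S) mu &
    forall t (f : S -> R[i]), bounded_functions f -> continuous (f : S -> R[i]^o) ->
      mu (ltrans t f) = mu f.
Proof.
move=> [e [inv [[mul1 mulx1] [mulV mulxV] mul_cont inv_cont]]] cS.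
have [m [mL mb m1 mI]] := @compact_group_real_mean R S e inv mul1 mulx1 mulxV mul_cont cS.
pose re (f : S -> R[i]) s := complex.Re (f s).
pose im (f : S -> R[i]) s := complex.Im (f s).
have reM f (M : R) : (forall s, normc (f s) <= M) -> forall s, `|re f s| <= M.
  by move=> fM s; apply: le_trans (normr_Re_le _) (fM s).
have imM f (M : R) : (forall s, normc (f s) <= M) -> forall s, `|im f s| <= M.
  by move=> fM s; apply: le_trans (normr_Im_le _) (fM s).
pose mu f : R[i] := m (re f) +i* m (im f).
have muL c f g : bounded_functions f -> bounded_functions g ->
    mu (fun s => c * f s + g s) = c * mu f + mu g.
  case: c => a b [M fM] [N gN].
  have comb1 : re (fun s => (a +i* b) * f s + g s) =
      (fun s => a * re f s + (fun s' => (- b) * im f s' + re g s') s).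
    by apply/funext => s; rewrite /re /im; case: (f s) => x y; case: (g s) => u v /=; ring.
  have comb2 : im (fun s => (a +i* b) * f s + g s) =
      (fun s => a * im f s + (fun s' => b * re f s' + im g s') s).
    by apply/funext => s; rewrite /re /im; case: (f s) => x y; case: (g s) => u v /=; ring.
  have bound (k : R) (p q : S -> R) : (forall s, `|p s| <= M) -> (forall s, `|q s| <= N) ->
      forall s, `|k * p s + q s| <= `|k| * M + N.
    move=> pM qN s; apply: le_trans (ler_normD _ _) _.
    by rewrite normrM lerD // ler_wpM2l.
  rewrite /mu comb1 comb2.
  rewrite (mL a (re f) _ M (`|- b| * M + N));
    [|exact: reM|exact: bound (imM _ _ fM) (reM _ _ gN)].
  rewrite (mL (- b) (im f) _ M N); [|exact: imM|exact: reM].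
  rewrite (mL a (im f) _ M (`|b| * M + N)); [|exact: imM|exact: bound (reM _ _ fM) (imM _ _ gN)].
  rewrite (mL b (re f) _ M N); [|exact: reM|exact: imM].
  by simpc; congr (_ +i* _); ring.
have m_const0 : m (cst 0) = 0.
  have h : forall s : S, `|cst 0 s : R| <= 0 by move=> s; rewrite normr0.
  by have := mb _ _ h; rewrite normr_le0 => /eqP.
exists mu; first split.
- exact: muL.
- move=> f C bf fC; have [c c1 cmu] := unimodular (mu f).
  have T := unital_bounded R S.
  have : mu (fun s => c * f s) = (normc (mu f))%:C.
    rewrite -cmu; have := muL c f (cst 0) bf (subspace0 T).
    have -> : mu (cst 0) = 0.
      by rewrite /mu [re _](_ : _ = cst 0) // [im _](_ : _ = cst 0) // m_const0.
    by rewrite addr0 => <-; congr mu; apply/funext => s /=; rewrite addr0.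
  move=> /(congr1 (@complex.Re R)) /= <-; apply: le_trans (ler_norm _) _.
  by apply: mb; apply: reM => s; rewrite Normc.normcM c1 mul1r.
- by rewrite /mu [re _](_ : _ = cst 1) // [im _](_ : _ = cst 0) // m1 m_const0.
move=> t f bf fc; rewrite /mu; congr (_ +i* _).
  by apply: (mI t (re f)); apply: (translation_continuous_comp mul1 mul_cont cS) => //;
    [exact: ReD | exact: normr_Re_le].
by apply: (mI t (im f)); apply: (translation_continuous_comp mul1 mul_cont cS) => //;
  [exact: ImD | exact: normr_Im_le].
Qed.

Lemma compact_group_projection (X : operatorSpaceType R) (alpha : S -> {linear X -> X}) :
  operator_S_space alpha -> compact [set: S] -> topological_group S ->
  (forall x, weakly_continuous (fun s => alpha s x)) -> has_projection alpha.
Proof.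
move=> alphaS cS Sgroup ac; have [mu mm mI] := compact_group_mean Sgroup cS.
have [e _] := Sgroup.
have [C [C0 EC aC]] := action_bound alphaS (ex_intro _ e I).
have aN := action_nrm aC.
apply: (totally_bounded_projection alphaS mm) => [x phi K t phiK|x r r0].
  apply: (mI t (fun s => phi (alpha s x))).
    apply: (@bounded_functional_comp _ _ _ _ _ (fun s => aN s x) phi `|K|) => // v.
    by apply: le_trans (phiK v) _; rewrite ler_wpM2r ?nrm_ge0 // ler_norm.
  exact: (weakly_continuous_functional (ac x) phiK).
(* The whole group is a compact neighbourhood of [e], so it serves as both compact sets. *)
have [|||l lP] := @weakly_continuous_orbit_totally_bounded R S X (@nrm R X) (fun s => alpha s)
    C x Sgroup (conj (@nrmD R X) (@nrmZ R X)) C0 _ _ _ e setT setT cS filterT cS r r0.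
- by case: alphaS.
- by move=> s u v; rewrite -linearB.
- move=> phi phi1; apply: (@weakly_continuous_functional _ _ _ _ phi 1 (ac x)) => v.
  by rewrite mul1r.
by exists l => s; exact: lP.
Qed.

End CompactGroupProjection.

Unset Implicit Arguments.
Local Close Scope complex_scope.

Theorem theorem3p1 (R : realType) (S : preTopologicalSemigroupType)
    (X : operatorSpaceType R) (alpha : S -> {linear X -> X})
    (alphaS : operator_S_space alpha) :
  [\/ (* (a) *)
      inhabited (dual_operator_S_space alpha) /\ amenable_semigroup R S,
      (* (b) *)
      exists D : dual_operator_S_space alpha,
        [/\ amenable_topological_group R S, locally_compact [set: S] &
            forall x, weak_star_continuous D (fun s => alpha s x)],
      (* (c) *)
      exists D : dual_operator_S_space alpha,
        amenable_topological_group R S /\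
        forall psi : D, continuous (fun s => preact D s psi)
    | (* (d), (e) or (f) *)
      [\/ [/\ compact [set: S], left_topological_semigroup S,
              amenable_semigroup R S &
              forall x, continuous (fun s => alpha s x)],
          [/\ separable X, compact [set: S], left_topological_semigroup S,
              amenable_semigroup R S &
              forall x, weakly_continuous (fun s => alpha s x)]
        | [/\ compact [set: S], topological_group S &
              forall x, weakly_continuous (fun s => alpha s x)]]] ->
  exists P : {linear X -> X},
    [/\ completely_bounded P /\
        (cbnorm P <= ereal_sup (range (fun s => cbnorm (alpha s))))%E,
        range P = fixed_points alpha &
        P \o P = P].
Proof.
case=> [[[D] amS]|[D [amS lcS ac]]|[D [amS ac]]|].
- have [mu mm mI] := amenable_mean (unital_bounded R S) amS.
  apply: (dual_projection alphaS (D := D) (unital_bounded R S) mm mI) => x psi.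
  have [C [C0 _ aC]] := action_bound alphaS (mean_nonempty (unital_bounded R S) mm).
  exists (C * nrm x * nrm psi) => s; apply: le_trans (pairing_bound _ _) _.
  by rewrite ler_wpM2r ?nrm_ge0 // (action_nrm aC).
- exact: (weak_star_continuous_dual_projection alphaS amS lcS ac).
- exact: (strongly_continuous_dual_projection alphaS amS ac).
- case=> [[cS _ amS ac]|[sepX cS _ amS ac]|[cS Sgroup ac]].
  + exact: (compact_norm_continuous_projection alphaS cS amS ac).
  + exact: (separable_weakly_continuous_projection alphaS sepX cS amS ac).
  + exact: (compact_group_projection alphaS cS Sgroup ac).
Qed.
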